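(* The Wilf-Stanley limit of the class of $4231$-avoiding permutations satisfies $L(4231) \geq 9.35$.
   Context: Permutations of $\{1,\dots,n\}$ are written as sequences of values. A permutation $\sigma=\sigma_1\cdots\sigma_k$ occurs as a pattern in $\pi=\pi_1\cdots\pi_n$ if some subsequence of $\pi$ of length $k$ has its values in the same relative order as the corresponding values of $\sigma$; otherwise $\pi$ avoids $\sigma$. For a permutation $\sigma$, let $s_n(\sigma)$ denote the number of permutations of $\{1,\dots,n\}$ that avoid $\sigma$. It is known (Marcus–Tardos together with Arratia) that the limit $L(\sigma)=\lim_{n\to\infty} s_n(\sigma)^{1/n}$ exists and is a finite real number; it is called the Wilf-Stanley limit of the class $\mathrm{Av}(\sigma)$ of all permutations avoiding $\sigma$. *)

(* Defs.v *)
From mathcomp Require Import all_boot all_order all_algebra.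
From mathcomp Require Import all_classical all_reals all_analysis.
Import numFieldNormedType.Exports.

Set Implicit Arguments.
Unset Strict Implicit.
Unset Printing Implicit Defensive.

Local Open Scope classical_set_scope.
Local Open Scope ring_scope.

(* Permutations of {1, ..., n} are represented by their sequences of values,
   i.e., by the elements of [permutations (iota 1 n)]; patterns are given in
   the same way. *)

Definition order_iso (s t : seq nat) : bool :=
  (size s == size t) &&
  [forall i : 'I_(size s), forall j : 'I_(size s),
    (nth 0%N s i < nth 0%N s j)%N == (nth 0%N t i < nth 0%N t j)%N].

(* The subsequences of [w] are the [mask m w], with [m] a bit vector of the
   same length as [w]. *)
Definition occurs (sigma w : seq nat) : bool :=
  [exists m : (size w).-tuple bool, order_iso (mask m w) sigma].

Definition avoids (sigma w : seq nat) : bool := ~~ occurs sigma w.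

Definition num_avoiders (sigma : seq nat) (n : nat) : nat :=
  count (avoids sigma) (permutations (iota 1 n)).

(* [lim] takes the default value 0 on divergent sequences, so a positive lower
   bound on [wilf_stanley_limit] entails that the limit exists in R. *)
Definition wilf_stanley_limit (R : realType) (sigma : seq nat) : R :=
  lim ((fun n : nat => (num_avoiders sigma n)%:R `^ (n%:R^-1) : R) @ \oo).

(* Main.v *)
Require Import Defs.
From Stdlib Require Import NArith.
From mathcomp Require Import all_boot all_order all_algebra all_fingroup.
From mathcomp Require Import all_classical all_reals all_analysis.
From mathcomp Require Import zify ring lra.

(** The limit exists because the number of avoiders is supermultiplicative
    ([avoider_count_super]) and grows at most exponentially ([avoider_count_le]);
    Fekete's argument then gives the limit [L] and the bound [L ^ n] on the number
    of avoiders of each size [n] ([fekete]).  For the exponential upper bound, the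
    entries of an avoider are split into a part that avoids 312 and a part that
    avoids 231 ([two_colouring]), and each part is determined by the places and
    the values of its records.

    The lower bound comes from permutations whose points lie in a staircase of
    cells, each cell being alternately to the right of the previous one, in the
    same rows, and above it, in the same columns.  In such a permutation a 4231 is
    confined to two adjacent cells, so only adjacent cells have to be compatible.
    A compatible pair of cells is a domino: if they lie side by side, then the left
    one avoids 312, the right one avoids 231, and there is no 4231; pairs of cells
    on top of each other are the inverses of these.  A chain may alternate dominoes
    with increasing cells, because an increasing cell interleaves freely with both
    its neighbours.  With [D] dominoes of [2 * p] points in each
    cell, and increasing cells of [p] points, each link of [5 * p] points
    multiplies the number of choices by [D] and by the square of the binomial
    coefficient of [3 * p] over [p] ([chain_count]).  If [d] denotes the
    exponential growth rate of dominoes per point, then [L ^ 5] is at least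
    [d ^ 4 * (27 / 4) ^ 2] ([domino_growth_le]), and [L >= 9.35] follows from
    [d >= 6.294]; the actual value of [d] is 27 / 4.

    To bound [d] from below, dominoes are grown by inserting their values in
    increasing order ([growths]).  The possible insertions are governed by a stack
    with two kinds of items.  Undoing the last insertion yields polynomial
    equations with nonnegative coefficients for generating functions indexed by a
    number of cuts ([growth_bounds_next]).  Iterating these equations from zero
    produces lower bounds for partial sums of the generating function of dominoes.
    At [z = 20 / 127] the bounds pass 20000 after 62 rounds, even if at most ten
    cuts are considered ([weighted_growths_large]).  If [L] were less than 9.35,
    there would be at most [6.294 ^ (a + b)] dominoes with [a] and [b] points in
    their cells, and the sum would stay below [(1 - 6.294 * z) ^ (-2)], which is
    less than 13000. *)

Set Implicit Arguments.
Unset Strict Implicit.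
Unset Printing Implicit Defensive.
Import Order.TTheory GRing.Theory Num.Theory.
Import numFieldNormedType.Exports.


(** * Avoiders as functions on the naturals *)

Lemma leq_card_inj (A B : finType) (P : pred A) (Q : pred B) (f : A -> B) :
  {in P, forall x, f x \in Q} -> {in P &, injective f} -> #|P| <= #|Q|.
Proof.
move=> PQ finj; rewrite -(card_in_image finj); apply: subset_leq_card.
by apply/fintype.subsetP => _ /fintype.imageP[x Px ->]; apply: PQ.
Qed.

(** Index arithmetic is easier on [nat] than on ['I_n]: a permutation of
    ['I_n] is read as a function on [nat], of which only the values below [n]
    matter. *)
Definition pfun n (p : 'S_n) (i : nat) : nat :=
  if insub i is Some j then val (p j) else i.

Lemma pfun_ord n (p : 'S_n) (i : 'I_n) : pfun p i = p i.
Proof. by rewrite /pfun valK. Qed.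

Lemma pfun_lt n (p : 'S_n) i : i < n -> pfun p i < n.
Proof. by move=> i_lt; rewrite (pfun_ord p (Ordinal i_lt)). Qed.

Lemma pfun_inj n (p : 'S_n) i j :
  i < n -> j < n -> pfun p i = pfun p j -> i = j.
Proof.
move=> i_lt j_lt; rewrite (pfun_ord p (Ordinal i_lt)) (pfun_ord p (Ordinal j_lt)).
by move/val_inj/perm_inj=> /(congr1 val).
Qed.

Lemma pfunK n (p : 'S_n) i : i < n -> pfun p^-1 (pfun p i) = i.
Proof.
by move=> i_lt; rewrite (pfun_ord p (Ordinal i_lt)) pfun_ord permK.
Qed.

Lemma pfunVK n (p : 'S_n) i : i < n -> pfun p (pfun p^-1 i) = i.
Proof. by move=> i_lt; rewrite -{1}[p]invgK pfunK. Qed.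

Lemma pfun1 n i : pfun (1 : 'S_n) i = i.
Proof. by rewrite /pfun; case: insubP => // j _ <-; rewrite perm1. Qed.

Lemma eq_pfun n (p q : 'S_n) :
  (forall i, i < n -> pfun p i = pfun q i) -> p = q.
Proof.
by move=> pq; apply/permP => i; apply/val_inj; rewrite /= -!pfun_ord pq.
Qed.

(** The permutation with a given graph, which makes constructions on
    permutations total functions; the default [1] only occurs when [f] does not
    permute the naturals below [n]. *)
Definition mkperm n (f : nat -> nat) : 'S_n :=
  odflt 1%g [pick p : 'S_n | [forall i : 'I_n, p i == f i :> nat]].

Lemma pfun_mkperm n (f : nat -> nat) :
    (forall i, i < n -> f i < n) ->
    (forall i j, i < n -> j < n -> f i = f j -> i = j) ->
  forall i, i < n -> pfun (mkperm n f) i = f i.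
Proof.
move=> f_lt f_inj i i_lt; rewrite /mkperm; case: pickP => [p /forallP fp | nop].
  by rewrite (pfun_ord p (Ordinal i_lt)) (eqP (fp (Ordinal i_lt))).
pose g (j : 'I_n) := Ordinal (f_lt j (ltn_ord j)).
have g_inj : injective g.
  by move=> j k /(congr1 val) /= /f_inj jk; apply/val_inj/jk.
by have /forallP[] := negbT (nop (perm g_inj)) => j; rewrite permE.
Qed.

Definition avoids4231 n (f : nat -> nat) : Prop :=
  forall i j k l, i < j -> j < k -> k < l -> l < n ->
  f l < f j -> f j < f k -> f k < f i -> False.

Definition avoider n : pred 'S_n := fun p => `[< avoids4231 n (pfun p) >].
Arguments avoider : clear implicits.

Definition avoider_count n := #|avoider n|.

Definition word_of n (p : 'S_n) := [seq (pfun p i).+1 | i <- iota 0 n].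

Lemma word_of_inj n : injective (@word_of n).
Proof.
move=> p q /eq_in_map pq; apply: eq_pfun => i i_lt.
by apply/eq_add_S/pq; rewrite mem_iota.
Qed.

Lemma permutations_word_of n :
  perm_eq (permutations (iota 1 n)) (map (@word_of n) (enum 'S_n)).
Proof.
apply: uniq_perm; first exact: permutations_uniq.
  by rewrite map_inj_uniq ?enum_uniq //; apply: word_of_inj.
move=> w; rewrite mem_permutations; apply/idP/mapP => [w_perm | [p _ ->]].
  have w_size : size w = n by rewrite (perm_size w_perm) size_iota.
  have w_uniq : uniq w by rewrite (perm_uniq w_perm) iota_uniq.
  have w_bound i : i < n -> 0 < nth 0 w i <= n.
    move=> i_lt; have : nth 0 w i \in w by rewrite mem_nth ?w_size.
    by rewrite (perm_mem w_perm) mem_iota; lia.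
  exists (mkperm n (fun i => (nth 0 w i).-1)); first by rewrite mem_enum.
  apply: (@eq_from_nth _ 0); first by rewrite size_map size_iota.
  move=> i; rewrite w_size => i_lt; rewrite (nth_map 0) ?size_iota // nth_iota //.
  rewrite pfun_mkperm ?add0n //.
  - by have := w_bound i i_lt; lia.
  - by move=> j /w_bound; lia.
  move=> j k j_lt k_lt /= jk; apply/eqP.
  rewrite -(nth_uniq 0 _ _ w_uniq) ?w_size //; apply/eqP.
  have pred_inj a b : 0 < a <= n -> 0 < b <= n -> a.-1 = b.-1 -> a = b by lia.
  exact: pred_inj (w_bound j j_lt) (w_bound k k_lt) jk.
apply: uniq_perm; last 1 first.
- move=> v; rewrite mem_iota; apply/mapP/idP => [[i] | v_bound].
    by rewrite mem_iota => /(pfun_lt p) + ->; lia.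
  exists (pfun p^-1 v.-1); last by rewrite pfunVK; lia.
  by rewrite mem_iota pfun_lt; lia.
- rewrite map_inj_in_uniq ?iota_uniq // => i j; rewrite !mem_iota => i_lt j_lt [].
  exact: pfun_inj.
- exact: iota_uniq.
Qed.

Lemma order_iso4231 w :
  order_iso w [:: 4; 2; 3; 1] =
  if w is [:: d; b; c; a] then [&& a < b, b < c & c < d] else false.
Proof.
rewrite /order_iso; case: w => [|d [|b [|c [|a [|e w]]]]] //=.
apply/forallP/idP => [iso | /and3P[ab bc cd]].
  have ord i j : i < 4 -> j < 4 ->
    (nth 0 [:: d; b; c; a] i < nth 0 [:: d; b; c; a] j) =
    (nth 0 [:: 4; 2; 3; 1] i < nth 0 [:: 4; 2; 3; 1] j).
    by move=> il jl; have /forallP/(_ (Ordinal jl))/eqP := iso (Ordinal il).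
  by have /= -> := ord 3 1 isT isT; have /= -> := ord 1 2 isT isT;
     have /= -> := ord 2 0 isT isT.
by case=> [[|[|[|[|i]]]] il] //; apply/forallP; case=> [[|[|[|[|j]]]] jl] //=; lia.
Qed.

Lemma occurs_word_of n (p : 'S_n) :
  occurs [:: 4; 2; 3; 1] (word_of p) <-> ~ avoids4231 n (pfun p).
Proof.
split=> [/existsP[m] | ].
  rewrite /word_of -map_mask order_iso4231.
  have : sorted ltn (mask m (iota 0 n)).
    by apply: sorted_mask (iota_ltn_sorted 0 n); apply: ltn_trans.
  have : {subset mask m (iota 0 n) <= iota 0 n} by move=> x; apply: mem_mask.
  case: (mask m _) => [|i [|j [|k [|l [|? ?]]]]] //= sub.
  case/and4P=> ij jk kl _ /and3P[ab bc cd] /(_ i j k l ij jk kl) [] //.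
  by have := sub l; rewrite mem_iota !inE eqxx !orbT => /(_ isT).
move=> /contra_notT; apply=> noocc i j k l ij jk kl ln lj jk' ki.
case/negP: noocc; apply/existsP.
have /subseqP[m m_size m_mask] : subseq [:: i; j; k; l] (iota 0 n).
  have -> : [:: i; j; k; l] = seq.filter (mem [:: i; j; k; l]) (iota 0 n).
    apply: (@irr_sorted_eq _ ltn ltn_trans ltnn); first by rewrite /= ij jk kl.
      by apply: sorted_filter (iota_ltn_sorted 0 n); apply: ltn_trans.
    move=> x; rewrite mem_filter mem_iota /=.
    by apply/idP/andP => [xin | []] //; split=> //; move: xin; rewrite !inE; lia.
  exact: filter_subseq.
have m_tuple : size m == size (word_of p) by rewrite m_size size_map.
exists (Tuple m_tuple); rewrite /word_of /= -map_mask -m_mask order_iso4231 /=.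
by rewrite !ltnS lj jk' ki.
Qed.

Lemma num_avoiders_count n : num_avoiders [:: 4; 2; 3; 1] n = avoider_count n.
Proof.
rewrite /num_avoiders /avoider_count (seq.permP (permutations_word_of n)) count_map.
have E (p : 'S_n) : avoids [:: 4; 2; 3; 1] (word_of p) = avoider n p; last first.
  by rewrite cardE !size_filter count_filter; apply: eq_count => p /=; rewrite E andbT.
rewrite /avoids; apply/idP/asboolP => [noocc | av].
  by apply: contrapT => /occurs_word_of; rewrite (negPf noocc).
by apply/negP => /occurs_word_of.
Qed.

Lemma avoider_count_ge1 n : 0 < avoider_count n.
Proof.
apply/card_gt0P; exists 1%g; rewrite unfold_in; apply/asboolP => i j k l.
by rewrite !pfun1; lia.
Qed.

(** A direct sum of avoiders is an avoider, because 4231 is not itself a direct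
    sum: its first entry exceeds its last one. *)
Lemma avoider_count_super m n :
  avoider_count m * avoider_count n <= avoider_count (m + n).
Proof.
pose f (p : 'S_m) (q : 'S_n) x := if x < m then pfun p x else m + pfun q (x - m).
have fE p q : forall x, x < m + n -> pfun (mkperm (m + n) (f p q)) x = f p q x.
  apply: pfun_mkperm => [x x_lt | x y x_lt y_lt]; rewrite /f.
    case: ifP => [/(pfun_lt p)|?]; first by lia.
    by have := @pfun_lt _ q (x - m); lia.
  case: ifP => xm; case: ifP => ym.
  - exact: pfun_inj.
  - by have := pfun_lt p xm; lia.
  - by have := pfun_lt p ym; lia.
  by move=> /addnI/pfun_inj; lia.
rewrite -cardX; apply: (@leq_card_inj _ _ [predX avoider m & avoider n] (avoider (m + n))
          (fun u => mkperm (m + n) (f u.1 u.2))).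
  case=> p q /andP[/= /asboolP avp /asboolP avq]; apply/asboolP => i j k l ij jk kl l_lt; rewrite !fE //; try lia; rewrite /f.
  have bd x : x < m -> pfun p x < m by exact: pfun_lt.
  case: (ltnP l m) => lm.
    have km := ltn_trans kl lm; have jm := ltn_trans jk km.
    rewrite jm km (ltn_trans ij jm); exact: avp ij jk kl lm.
  case: (ltnP i m) => im; first by have := bd i im; do 2?[case: ifP => _]; lia.
  have [jm km] : (j < m) = false /\ (k < m) = false by lia.
  rewrite jm km !ltn_add2l; apply: avq; lia.
case=> p q [p' q'] _ _ /= /(congr1 (fun r x => pfun r x)) E.
have {}E x : x < m + n -> f p q x = f p' q' x.
  by move=> x_lt; have /(congr1 (fun g => g x)) := E; rewrite !fE.
congr pair; apply: eq_pfun => x x_lt.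
  by have := E x; rewrite /f x_lt; apply; lia.
have := E (m + x); rewrite /f (_ : m + x < m = false); last lia.
by rewrite addKn => /(_ ltac:(lia))/addnI.
Qed.

(** * An exponential upper bound *)

Definition no312_on n (P : pred nat) (f : nat -> nat) : Prop :=
  forall i j k, i < j -> j < k -> k < n -> P i -> P j -> P k ->
  f j < f k -> f k < f i -> False.

Definition no231_on n (P : pred nat) (f : nat -> nat) : Prop :=
  forall i j k, i < j -> j < k -> k < n -> P i -> P j -> P k ->
  f k < f i -> f i < f j -> False.

Definition record_max (P : pred nat) (f : nat -> nat) i : Prop :=
  forall j, j < i -> P j -> f j < f i.

Definition record_min n (P : pred nat) (f : nat -> nat) i : Prop :=
  forall j, i < j -> j < n -> P j -> f i < f j.

Definition inj_on n (P : pred nat) (f : nat -> nat) : Prop :=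
  forall i j, i < n -> j < n -> P i -> P j -> f i = f j -> i = j.

Definition covered_by n (P : pred nat) (rec : (nat -> nat) -> nat -> Prop)
    (f g : nat -> nat) : Prop :=
  forall i, i < n -> P i ->
  exists j, [/\ j < n, P j, g j = f i & rec f i -> rec g j].

(** At the first position [p] where [f] and [g] differ, [f] cannot be the smaller
    one: if [p] is a record, then [f p] is a record value of [g] at a later
    position, hence above [g p]; otherwise [g p] is taken by [f] after [p] and a
    larger value before, which makes a 312. *)
Lemma first_difference312 n (P : pred nat) (f g : nat -> nat) p :
  no312_on n P f -> inj_on n P f -> inj_on n P g ->
  covered_by n P (record_max P) f g -> covered_by n P (record_max P) g f ->
  p < n -> P p -> (record_max P g p -> record_max P f p) ->
  (forall q, q < p -> P q -> f q = g q) -> g p <= f p.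
Proof.
move=> f312 f_inj g_inj fg gf pn Pp grec_frec agree.
case: leqP => // fp_lt.
case: (pselect (record_max P g p)) => [grec | /existsNP[r /not_implyP[rp]]].
  have [q [qn Pq gq qrec]] := fg p pn Pp.
  have {}qrec := qrec (grec_frec grec).
  case: (ltngtP q p) => [qp | pq | qp]; last by move: gq; rewrite qp; lia.
    by have := f_inj q p qn pn Pq Pp; rewrite (agree q) // => /(_ gq); lia.
  by have := qrec p pq Pp; lia.
move=> /not_implyP[Pr /negP gr].
have {}gr : g p < g r.
  by have := g_inj p r pn (ltn_trans rp pn) Pp Pr; lia.
have [q [qn Pq fq _]] := gf p pn Pp.
case: (ltngtP q p) => [qp | pq | qp]; last by move: fq; rewrite qp; lia.
  by have := g_inj q p qn pn Pq Pp; rewrite -(agree q) // => /(_ fq); lia.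
have := f312 r p q rp pq qn Pr Pp Pq; rewrite (agree r) // fq.
by case/(_ fp_lt gr).
Qed.

(** A 312-avoiding bijection between two given sets is determined by the
    positions and the values of its left-to-right maxima: any other entry has to
    be the largest value still unused below the current maximum, since a larger
    unused one would appear later and complete a 312. *)
Lemma determined_by_max n (P : pred nat) (f g : nat -> nat) :
  no312_on n P f -> no312_on n P g -> inj_on n P f -> inj_on n P g ->
  covered_by n P (record_max P) f g -> covered_by n P (record_max P) g f ->
  (forall p, p < n -> P p -> record_max P f p <-> record_max P g p) ->
  forall p, p < n -> P p -> f p = g p.
Proof.
move=> f312 g312 f_inj g_inj fg gf recE; elim/ltn_ind => p IH pn Pp.
have agree q : q < p -> P q -> f q = g q.
  by move=> qp Pq; apply: IH (ltn_trans qp pn) Pq.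
have agree' q : q < p -> P q -> g q = f q by move=> qp Pq; rewrite agree.
apply/eqP; rewrite eqn_leq.
rewrite (first_difference312 g312 g_inj f_inj gf fg pn Pp _ agree'); last first.
  by case: (recE p pn Pp).
rewrite (first_difference312 f312 f_inj g_inj fg gf pn Pp _ agree) //.
by case: (recE p pn Pp).
Qed.

(** The half-turn exchanges 231 with 312, and right-to-left minima with
    left-to-right maxima. *)
Lemma determined_by_min n (P : pred nat) (f g : nat -> nat) :
  (forall i, i < n -> f i < n) -> (forall i, i < n -> g i < n) ->
  no231_on n P f -> no231_on n P g -> inj_on n P f -> inj_on n P g ->
  covered_by n P (record_min n P) f g -> covered_by n P (record_min n P) g f ->
  (forall p, p < n -> P p -> record_min n P f p <-> record_min n P g p) ->
  forall p, p < n -> P p -> f p = g p.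
Proof.
pose turn (h : nat -> nat) i := n.-1 - h (n.-1 - i).
pose Q i := (i < n) && P (n.-1 - i).
have revK i : i < n -> n.-1 - (n.-1 - i) = i by lia.
have rev_lt i : i < n -> n.-1 - i < n by lia.
have no312 h : (forall i, i < n -> h i < n) -> no231_on n P h ->
    no312_on n Q (turn h).
  move=> hn h231 i j k ij jk kn /andP[il Pi] /andP[jl Pj] /andP[kl Pk].
  rewrite /turn => hjk hki.
  have := h231 (n.-1 - k) (n.-1 - j) (n.-1 - i).
  have := hn _ (rev_lt _ il); have := hn _ (rev_lt _ jl).
  by have := hn _ (rev_lt _ kl); move=> ? ? ? /(_ _ _ _ Pk Pj Pi) H; apply: H; lia.
have inj h : (forall i, i < n -> h i < n) -> inj_on n P h -> inj_on n Q (turn h).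
  move=> hn h_inj i j il jl /andP[_ Pi] /andP[_ Pj]; rewrite /turn => hij.
  have := h_inj (n.-1 - i) (n.-1 - j) (rev_lt _ il) (rev_lt _ jl) Pi Pj.
  by have := hn _ (rev_lt _ il); have := hn _ (rev_lt _ jl); lia.
have rec h i : (forall i, i < n -> h i < n) -> i < n ->
    record_max Q (turn h) i <-> record_min n P h (n.-1 - i).
  move=> hn il; split=> [hrec j ij jl Pj | hrec j ji /andP[jl Pj]].
    have := hrec (n.-1 - j); rewrite /turn /Q revK // Pj rev_lt // => /(_ _ isT).
    by have := hn _ jl; have := hn _ (rev_lt _ il); lia.
  rewrite /turn; have := hrec (n.-1 - j) _ (rev_lt _ jl) Pj.
  by have := hn _ (rev_lt _ jl); have := hn _ (rev_lt _ il); lia.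
have cov h h' : (forall i, i < n -> h i < n) -> (forall i, i < n -> h' i < n) ->
    covered_by n P (record_min n P) h h' ->
    covered_by n Q (record_max Q) (turn h) (turn h').
  move=> hn hn' hh' i il /andP[_ Pi].
  have [j [jl Pj jE jrec]] := hh' _ (rev_lt _ il) Pi.
  exists (n.-1 - j); rewrite /Q revK // Pj rev_lt //; split=> //.
    by rewrite /turn revK // jE.
  by move/(rec h _ hn il)/jrec => ?; apply/(rec h'); rewrite ?rev_lt ?revK.
move=> fn gn f231 g231 f_inj g_inj fg gf recE p pn Pp.
have turnE : turn f (n.-1 - p) = turn g (n.-1 - p).
  apply: (@determined_by_max n Q); rewrite ?rev_lt //; try by auto.
    move=> q qn /andP[_ Qq]; rewrite (rec f) // (rec g) //.
    by apply: recE => //; apply: rev_lt.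
  by rewrite /Q revK // rev_lt.
by move: turnE; rewrite /turn revK //; have := fn p pn; have := gn p pn; lia.
Qed.

(** Definition by course-of-values recursion of a predicate. *)
Lemma fixpoint_below (Phi : (nat -> bool) -> nat -> bool) :
  (forall f g i, (forall j, j < i -> f j = g j) -> Phi f i = Phi g i) ->
  exists f : nat -> bool, forall i, f i = Phi f i.
Proof.
move=> PhiE.
pose F k := iter k (fun f i => Phi f i) (fun=> false).
have stable k i : i < k -> F k i = F i.+1 i.
  elim/ltn_ind: i k => i IH [|k] // ik; rewrite /F /=; apply: PhiE => j ji.
  by rewrite -/(F k) -/(F i) (IH j) ?(IH j ji i) //; lia.
exists (fun i => F i.+1 i) => i; rewrite {1}/F /=; apply: PhiE => j ji.
by rewrite -/(F i) stable.
Qed.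

(** Colour the entries greedily from left to right: an entry turns blue if a
    blue entry above it came before, or if otherwise it would complete a red 312.
    Red then avoids 312 by construction.  A blue 231, say [b c a], extends to a
    4231: the first blue entry from which [c] inherits its colour, call it [d],
    ends a 312 pattern [x y d] with [x] and [y] red and [x > d >= c]; if [x]
    comes before [b] then [x b c a] is a 4231, and otherwise [y] comes after [b],
    being red it exceeds [b], and [x y d a] is a 4231. *)
Lemma two_colouring n (f : nat -> nat) : avoids4231 n f ->
  exists col : pred nat,
    no312_on n (fun i => ~~ col i) f /\ no231_on n (fun i => col i) f.
Proof.
move=> av.
pose Phi (col : nat -> bool) i := `[< (exists j, [/\ j < i, col j & f i < f j]) \/
  (exists j k, [/\ j < k, k < i, ~~ col j, ~~ col k & f k < f i < f j]) >].
have [|col colE] := @fixpoint_below Phi.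
  move=> c c' i cc'; apply/asboolP/asboolP.
    case=> [[j [ji cj fj]] | [j [k [jk ki cj ck fjk]]]]; [left | right].
      by exists j; rewrite -cc'.
    by exists j, k; rewrite -!cc' //; apply: ltn_trans ki.
  case=> [[j [ji cj fj]] | [j [k [jk ki cj ck fjk]]]]; [left | right].
    by exists j; rewrite cc'.
  by exists j, k; rewrite !cc' //; apply: ltn_trans ki.
exists col; split=> [i j k ij jk kn ci cj + fjk fki | i j k ij jk kn ci cj ck].
  rewrite colE => /negP; apply; apply/asboolP; right; exists i, j.
  by rewrite fjk fki.
have blue_origin m : col m -> exists x y d,
    [/\ x < y < d, d <= m, ~~ col x, ~~ col y & f y < f d < f x /\ f m <= f d].
  elim/ltn_ind: m => m IH; rewrite colE => /asboolP[[p [pm cp fp]] | ].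
    have [x [y [d [xyd dp cx cy [fyx fpd]]]]] := IH p pm cp.
    exists x, y, d; split=> //; first by apply: leq_trans dp (ltnW pm).
    by split=> //; apply: leq_trans (ltnW fp) fpd.
  case=> x [y [xy ym cx cy fyx]].
  by exists x, y, m; split=> //; rewrite xy.
have [x [y [d [/andP[xy yd] dj cx cy [/andP[fyd fdx] fjd]]]]] := blue_origin j cj.
move=> fki fij.
case: (ltngtP x i) => [xi | ix | xi]; last by rewrite xi ci in cx.
  by apply: (av x i j k) => //; apply: leq_ltn_trans fdx.
have fiy : f i <= f y.
  case: leqP => // fyi; move: cy; rewrite colE => /negP[]; apply/asboolP; left.
  by exists i; split=> //; apply: ltn_trans xy.
apply: (av x y d k) => //; first exact: leq_ltn_trans jk.
exact: leq_trans fki fiy.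
Qed.

(** An avoider is determined by four bits for each index [i]: the colour of the
    entry at position [i] and that of the entry with value [i], and whether
    either is a record of its colour class. *)
Lemma avoider_count_le n : avoider_count n <= 16 ^ n.
Proof.
pose good (p : {perm 'I_n}) (col : pred nat) :=
  no312_on n (fun i => ~~ col i) (pfun p) /\ no231_on n (fun i => col i) (pfun p).
pose col (p : {perm 'I_n}) : pred nat :=
  if pselect (exists c, good p c) is left e
  then fun i => (i < n) && projT1 (cid e) i else pred0.
have colP p : avoider n p -> good p (col p).
  move=> /asboolP/two_colouring ex; rewrite /col; case: pselect => // e.
  case: cid => /= c [c312 c231]; split=> i j k ij jk kn.
    rewrite kn (ltn_trans jk kn) (ltn_trans ij (ltn_trans jk kn)).
    exact: c312.
  rewrite kn (ltn_trans jk kn) (ltn_trans ij (ltn_trans jk kn)).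
  exact: c231.
have col_out p i : n <= i -> col p i = false.
  by rewrite /col; case: pselect => // e; rewrite leqNgt => /negPf ->.
pose rec (p : {perm 'I_n}) i := if col p i
  then `[< record_min n (fun j => col p j) (pfun p) i >]
  else `[< record_max (fun j => ~~ col p j) (pfun p) i >].
pose code (p : {perm 'I_n}) := [ffun i : 'I_n =>
  (col p i, rec p i, (col p (pfun p^-1 i), rec p (pfun p^-1 i)))].
have -> : 16 ^ n = #|{ffun 'I_n -> bool * bool * (bool * bool)}|.
  by rewrite card_ffun !card_prod card_bool card_ord.
apply: (@leq_card_inj _ _ _ _ code) => // p q avp avq /ffunP codeE.
have [p312 p231] := colP p avp; have [q312 q231] := colP q avq.
have {}codeE i : i < n -> [/\ col p i = col q i, rec p i = rec q i,
    col p (pfun p^-1 i) = col q (pfun q^-1 i) &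
    rec p (pfun p^-1 i) = rec q (pfun q^-1 i)].
  by move=> il; have := codeE (Ordinal il); rewrite !ffunE => -[].
have colE : col q = col p.
  apply/funext => i; case: (ltnP i n) => [/codeE[]//|ni].
  by rewrite !col_out.
rewrite colE in q312 q231.
have recE i : i < n -> rec p i = rec q i by case/codeE.
have lt_p i : i < n -> pfun p i < n by exact: pfun_lt.
have lt_q i : i < n -> pfun q i < n by exact: pfun_lt.
have value i : i < n -> exists j,
    [/\ j < n, col p j = col p i, pfun q j = pfun p i & rec q j = rec p i].
  move=> il; have [_ _] := codeE _ (lt_p i il); rewrite pfunK // colE => cE rE.
  by exists (pfun q^-1 (pfun p i)); rewrite pfunVK ?pfun_lt ?lt_p.
have value' i : i < n -> exists j,
    [/\ j < n, col p j = col p i, pfun p j = pfun q i & rec p j = rec q i].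
  move=> il; have [_ _] := codeE _ (lt_q i il); rewrite pfunK // colE => cE rE.
  by exists (pfun p^-1 (pfun q i)); rewrite pfunVK ?pfun_lt ?lt_q.
have inj (r : {perm 'I_n}) P : inj_on n P (pfun r).
  by move=> i j il jl _ _; apply: pfun_inj.
rewrite /rec colE in value value' recE.
apply: eq_pfun => i il; case ci : (col p i).
  apply: (@determined_by_min n (fun j => col p j)) => //.
  - move=> j jl cj; have [k [kl ck pk rk]] := value j jl.
    exists k; split=> //; first by rewrite ck.
    by move: rk; rewrite ck cj => rk /asboolP; rewrite -rk => /asboolP.
  - move=> j jl cj; have [k [kl ck pk rk]] := value' j jl.
    exists k; split=> //; first by rewrite ck.
    by move: rk; rewrite ck cj => rk /asboolP; rewrite -rk => /asboolP.
  - move=> j jl cj; have := recE j jl; rewrite cj => rE.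
    by split=> /asboolP rp; apply/asboolP; rewrite ?rE // -rE.
apply: (@determined_by_max n (fun j => ~~ col p j)) => //; last by rewrite ci.
- move=> j jl cj; have [k [kl ck pk rk]] := value j jl.
  exists k; split=> //; first by rewrite ck.
  by move: rk; rewrite ck (negPf cj) => rk /asboolP; rewrite -rk => /asboolP.
- move=> j jl cj; have [k [kl ck pk rk]] := value' j jl.
  exists k; split=> //; first by rewrite ck.
  by move: rk; rewrite ck (negPf cj) => rk /asboolP; rewrite -rk => /asboolP.
- move=> j jl cj; have := recE j jl; rewrite (negPf cj) => rE.
  by split=> /asboolP rp; apply/asboolP; rewrite ?rE // -rE.
Qed.

(** * Dominoes *)

(** A domino consists of two horizontally adjacent cells, with [a] points in the
    left one and [b] in the right one.  The last condition only has to deal with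
    the 4231 that have two points in each cell, since the first two conditions
    already exclude the others. *)
Definition is_domino a b (f : nat -> nat) : Prop :=
  [/\ no312_on a xpredT f, no231_on (a + b) (leq a) f &
      forall i j k l, i < j -> j < a -> a <= k -> k < l -> l < a + b ->
      f l < f j -> f j < f k -> f k < f i -> False].

Definition domino a b : pred 'S_(a + b) := fun p => `[< is_domino a b (pfun p) >].
Arguments domino : clear implicits.

Definition domino_count a b := #|domino a b|.

(** The half-turn exchanges the two cells: it fixes 4231 and swaps 312 with
    231. *)
Lemma domino_count_sym a b : domino_count a b <= domino_count b a.
Proof.
have [n nE] : exists n, n = a + b by exists (a + b).
pose f (p : 'S_(a + b)) i := n.-1 - pfun p (n.-1 - i).
have bd (p : 'S_(a + b)) i : i < n -> pfun p (n.-1 - i) < n.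
  by move=> il; rewrite {2}nE; apply: pfun_lt; lia.
have fE p : forall x, x < b + a -> pfun (mkperm (b + a) (f p)) x = f p x.
  apply: pfun_mkperm => [x|x y]; rewrite addnC -nE => xl; rewrite /f.
    by have := bd p x xl; lia.
  move=> yl; have := bd p x xl; have := bd p y yl => ly lx E.
  have /pfun_inj : pfun p (n.-1 - x) = pfun p (n.-1 - y).
    by move: lx ly E; do 2!move: (pfun p _); lia.
  by move=> /(_ ltac:(lia) ltac:(lia)); lia.
apply: (@leq_card_inj _ _ _ _ (fun p => mkperm (b + a) (f p))).
  move=> p /asboolP[p312 p231 pX]; apply/asboolP; split.
  - move=> i j k ij jk kb _ _ _; rewrite !fE; [|lia..]; rewrite /f => ? ?.
    have := bd p i _; have := bd p j _; have := bd p k _ => kn jn iN.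
    apply: (p231 (n.-1 - k) (n.-1 - j) (n.-1 - i)); try lia.
  - move=> i j k ij jk kb bi _ _; rewrite !fE; [|lia..]; rewrite /f => ? ?.
    have := bd p i _; have := bd p j _; have := bd p k _ => kn jn iN.
    apply: (p312 (n.-1 - k) (n.-1 - j) (n.-1 - i)); try lia.
  - move=> i j k l ij jb bk kl ll; rewrite !fE; [|lia..]; rewrite /f => ? ? ?.
    have := bd p i _; have := bd p j _; have := bd p k _; have := bd p l _.
    move=> ln kn jn iN.
    apply: (pX (n.-1 - l) (n.-1 - k) (n.-1 - j) (n.-1 - i)); try lia.
move=> p q _ _ pq; apply: eq_pfun => i il.
have : f p (n.-1 - i) = f q (n.-1 - i) by rewrite -!fE ?pq //; lia.
rewrite /f (_ : n.-1 - (n.-1 - i) = i); last by lia.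
by have := pfun_lt p il; have := pfun_lt q il; lia.
Qed.

(** The witness puts the second domino above the first, cell by cell to the
    right.  Every inversion inside a cell then lies within one of the two
    dominoes, and so does every forbidden pattern. *)
Lemma domino_count_super a b a' b' :
  domino_count a b * domino_count a' b' <= domino_count (a + a') (b + b').
Proof.
pose f (p : 'S_(a + b)) (q : 'S_(a' + b')) x :=
  if x < a then pfun p x else
  if x < a + a' then a + b + pfun q (x - a) else
  if x < a + a' + b then pfun p (x - a') else a + b + pfun q (x - a - b).
have fE p q : forall x, x < a + a' + (b + b') ->
    pfun (mkperm (a + a' + (b + b')) (f p q)) x = f p q x.
  apply: pfun_mkperm => [x xl | x y xl yl]; rewrite /f.
    have lp := @pfun_lt _ p; have lq := @pfun_lt _ q.
    have := lp x; have := lp (x - a'); have := lq (x - a); have := lq (x - a - b).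
    by do !case: ifP => ?; lia.
  have lp := @pfun_lt _ p; have ip := @pfun_inj _ p; have iq := @pfun_inj _ q.
  have lpx := lp x; have lpx' := lp (x - a').
  have lpy := lp y; have lpy' := lp (y - a').
  case: ifP => xa; [|case: ifP => xa'; [|case: ifP => xb]];
  (case: ifP => ya; [|case: ifP => ya'; [|case: ifP => yb]]) => E;
  try (exfalso; lia).
  - by apply: ip => //; lia.
  - by have := ip _ _ _ _ E; lia.
  - by have := iq _ _ _ _ (addnI E); lia.
  - by have := iq _ _ _ _ (addnI E); lia.
  - by have := ip _ _ _ _ E; lia.
  - by have := ip _ _ _ _ E; lia.
  - by have := iq _ _ _ _ (addnI E); lia.
  - by have := iq _ _ _ _ (addnI E); lia.
rewrite -cardX; apply: (@leq_card_inj _ _ [predX domino a b & domino a' b']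
   (domino (a + a') (b + b')) (fun u => mkperm (a + a' + (b + b')) (f u.1 u.2))).
  case=> p q /andP[/= /asboolP[p312 p231 pX] /asboolP[q312 q231 qX]].
  have lp := @pfun_lt _ p.
  apply/asboolP; split.
  - move=> i j k ij jk kl _ _ _; rewrite !fE; [|lia..]; rewrite /f.
    rewrite kl (ltn_trans jk kl) (ltn_trans ij (ltn_trans jk kl)).
    have li := lp i; have lj := lp j; have lk := lp k.
    case: (ltnP k a) => ka; case: (ltnP j a) => ja; case: (ltnP i a) => ia;
      try lia.
      exact: p312.
    by move=> ? ?; apply: (q312 (i - a) (j - a) (k - a)) => //; lia.
  - move=> i j k ij jk kl il _ _; rewrite !fE; [|lia..]; rewrite /f.
    have [il' [jl kl']] : i < a + a' = false /\ j < a + a' = false /\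
      k < a + a' = false by lia.
    have [ia [ja ka]] : i < a = false /\ j < a = false /\ k < a = false by lia.
    rewrite il' jl kl' ia ja ka.
    have li := lp (i - a'); have lj := lp (j - a'); have lk := lp (k - a').
    case: (ltnP k (a + a' + b)) => kb; case: (ltnP j (a + a' + b)) => jb;
      case: (ltnP i (a + a' + b)) => ib; try lia.
      by apply: (p231 (i - a') (j - a') (k - a')) => //; lia.
    by move=> ? ?; apply: (q231 (i - a - b) (j - a - b) (k - a - b)) => //; lia.
  - move=> i j k l ij jl kl' kl ll; rewrite !fE; [|lia..]; rewrite /f.
    rewrite jl (ltn_trans ij jl).
    have [kl2 ll2] : k < a + a' = false /\ l < a + a' = false by lia.
    have [ka la] : k < a = false /\ l < a = false by lia.
    rewrite kl2 ll2 ka la.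
    have li := lp i; have lj := lp j; have lk := lp (k - a'); have lL := lp (l - a').
    case: (ltnP l (a + a' + b)) => lb; case: (ltnP k (a + a' + b)) => kb;
    case: (ltnP j a) => ja; case: (ltnP i a) => ia; try lia.
      by apply: (pX i j (k - a') (l - a')) => //; lia.
    move=> ? ? ?; apply: (qX (i - a) (j - a) (k - a - b) (l - a - b)) => //; lia.
case=> p q [p' q'] _ _ /= E.
have {}E x : x < a + a' + (b + b') -> f p q x = f p' q' x.
  by move=> xl; rewrite -!fE // E.
congr pair; apply: eq_pfun => x xl.
  case: (ltnP x a) => xa; first by have := E x; rewrite /f xa; apply; lia.
  have := E (x + a'); rewrite /f addnK.
  have [-> [-> ->]] : x + a' < a = false /\ x + a' < a + a' = false /\
    x + a' < a + a' + b by lia.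
  by apply; lia.
case: (ltnP x a') => xa.
  have := E (a + x); rewrite /f addKn.
  have [-> ->] : a + x < a = false /\ a + x < a + a' by lia.
  by move=> /(_ ltac:(lia))/addnI.
have := E (a + b + x); rewrite /f (_ : a + b + x - a - b = x); last lia.
have [-> [-> ->]] : a + b + x < a = false /\ a + b + x < a + a' = false /\
  a + b + x < a + a' + b = false by lia.
by move=> /(_ ltac:(lia))/addnI.
Qed.

(** * Gluing a new cell to a permutation *)

(** The order-preserving map onto [V], since [enum] lists ['I_n] in increasing
    order; the default [0] only occurs from [#|V|] on. *)
Definition enum_below n (V : {set 'I_n}) i := nth 0 (map val (enum V)) i.

Lemma enum_belowP n (V : {set 'I_n}) i :
  i < #|V| -> exists2 v : 'I_n, v \in V & enum_below V i = v.
Proof.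
move=> il; have : enum_below V i \in map val (enum V).
  by rewrite mem_nth // size_map -cardE.
by case/mapP => v; rewrite mem_enum; exists v.
Qed.

Lemma enum_below_lt n (V : {set 'I_n}) i : i < #|V| -> enum_below V i < n.
Proof. by case/enum_belowP => v _ ->. Qed.

Lemma enum_below_mono n (V : {set 'I_n}) i j :
  i < j -> j < #|V| -> enum_below V i < enum_below V j.
Proof.
move=> ij jl; rewrite /enum_below.
have sorted_V : sorted ltn (map val (enum V)).
  apply: (@subseq_sorted _ ltn ltn_trans _ (iota 0 n)); last exact: iota_ltn_sorted.
  have -> : enum V = seq.filter (mem V) (enum 'I_n) by rewrite enumT.
  by rewrite -val_enum_ord map_subseq // filter_subseq.
apply: (sorted_ltn_nth ltn_trans 0 sorted_V) => //; rewrite inE size_map -cardE //.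
exact: ltn_trans jl.
Qed.

Lemma enum_below_inj n (V : {set 'I_n}) i j :
  i < #|V| -> j < #|V| -> enum_below V i = enum_below V j -> i = j.
Proof.
move=> il jl E; case: (ltngtP i j) => // [ij|ji].
  by have := enum_below_mono ij jl; rewrite E ltnn.
by have := enum_below_mono ji il; rewrite E ltnn.
Qed.

Lemma enum_below_onto n (V : {set 'I_n}) (v : 'I_n) :
  v \in V -> exists2 i, i < #|V| & enum_below V i = v.
Proof.
move=> vV; exists (index v (enum V)); first by rewrite cardE index_mem mem_enum.
rewrite /enum_below (nth_map v) ?index_mem ?mem_enum //=.
by rewrite nth_index ?mem_enum.
Qed.

Lemma enum_below_lt_iff n (V : {set 'I_n}) i j :
  i < #|V| -> j < #|V| -> (enum_below V i < enum_below V j) = (i < j).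
Proof.
move=> il jl; case: (ltngtP i j) => [ij|ji|->]; last by rewrite ltnn.
  exact: enum_below_mono.
by have := enum_below_mono ji il; lia.
Qed.

Lemma glue_card_setC s t (V : {set 'I_(s + t)}) : #|V| = t -> #|~: V| = s.
Proof. by move=> Vt; have := cardsC V; rewrite Vt card_ord; lia. Qed.

(** The permutation [p] of size [N] is first inverted, so that its last [s]
    positions become its top [s] values; then a cell with pattern [q] is appended
    on the right, its values interleaving with these top [s] values in the way
    recorded by the set [V], which lists the new cell's ranks among the
    [s + t] top values.  Thanks to the inversion, a chain of cells that turns
    alternately right and upwards arises by iterating one and the same step. *)
Section Glue.
Variables (N s t : nat).

Definition glue_fun (p : 'S_N) (V : {set 'I_(s + t)}) (q : 'S_t) x :=
  if x < N then
    let v := pfun p^-1 x in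
    if v < N - s then v else N - s + enum_below (~: V) (v - (N - s))
  else N - s + enum_below V (pfun q (x - N)).

Definition glue p V q : 'S_(N + t) := mkperm (N + t) (glue_fun p V q).

Hypothesis sN : s <= N.

Lemma pfun_glue p (V : {set 'I_(s + t)}) q x : #|V| = t -> x < N + t ->
  pfun (glue p V q) x = glue_fun p V q x.
Proof.
move=> Vt; have VCs := glue_card_setC Vt; move: x.
apply: pfun_mkperm => [x xl | x y xl yl]; rewrite /glue_fun.
  have lp := @pfun_lt _ p^-1 x; have lq := @pfun_lt _ q (x - N).
  case: ifP => [/lp pl | xN] /=.
    case: ifP => ?; first by lia.
    by have := @enum_below_lt _ (~: V) (pfun p^-1 x - (N - s)); lia.
  by have := @enum_below_lt _ V (pfun q (x - N)); lia.
have ip := @pfun_inj _ p^-1 x y; have iq := @pfun_inj _ q (x - N) (y - N).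
have lpx := @pfun_lt _ p^-1 x; have lpy := @pfun_lt _ p^-1 y.
have lqx := @pfun_lt _ q (x - N); have lqy := @pfun_lt _ q (y - N).
have disj i j : i < s -> j < t -> enum_below (~: V) i <> enum_below V j.
  move=> il jl; have il' : i < #|~: V| by rewrite VCs.
  have jl' : j < #|V| by rewrite Vt.
  have [v + ->] := enum_belowP il'; have [w wV ->] := enum_belowP jl'.
  by move=> + /val_inj vw; rewrite vw inE wV.
case: (ltnP x N) => xN; case: (ltnP y N) => yN /=.
- case: (ltnP (pfun p^-1 x) (N - s)) => xs; case: (ltnP (pfun p^-1 y) (N - s)) => ys;
    try lia.
  by move=> /addnI/enum_below_inj; rewrite VCs; lia.
- case: (ltnP (pfun p^-1 x) (N - s)) => xs; first by lia.
  by move/addnI/disj; lia.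
- case: (ltnP (pfun p^-1 y) (N - s)) => ys; first by lia.
  by move/addnI/esym/disj; lia.
by move=> /addnI/enum_below_inj; rewrite Vt; lia.
Qed.

Lemma glue_inj p (V : {set 'I_(s + t)}) q p' (V' : {set 'I_(s + t)}) q' :
  #|V| = t -> #|V'| = t ->
  glue p V q = glue p' V' q' -> [/\ p = p', V = V' & q = q'].
Proof.
move=> Vt V't E.
have {}E x : x < N + t -> glue_fun p V q x = glue_fun p' V' q' x.
  by move=> xl; rewrite -!pfun_glue // E.
have Enew j : j < t -> enum_below V (pfun q j) = enum_below V' (pfun q' j).
  move=> jt; have := E (N + j); rewrite /glue_fun addKn.
  have -> /= : (N + j < N) = false by lia.
  by move=> /(_ ltac:(lia))/addnI.
have VV' : V = V'.
  apply/eqP; rewrite eqEcard Vt V't leqnn andbT; apply/fintype.subsetP => v vV.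
  have [i il iv] := enum_below_onto vV.
  have jl : pfun q^-1 i < t by apply: pfun_lt; rewrite -Vt.
  have := Enew _ jl; rewrite pfunVK ?iv -?Vt //.
  have q'l : pfun q' (pfun q^-1 i) < #|V'| by rewrite V't pfun_lt.
  by have [w wV' ->] := enum_belowP q'l; move=> /val_inj ->.
rewrite -VV' in E Enew.
split=> //; last first.
  by apply: eq_pfun => j jt; apply: enum_below_inj (Enew j jt); rewrite Vt pfun_lt.
suff key x : x < N -> pfun p^-1 x = pfun p'^-1 x by apply/invg_inj/eq_pfun.
move=> xN; have := E x; rewrite /glue_fun xN /= => /(_ ltac:(lia)).
have VCs := glue_card_setC Vt.
have := @pfun_lt _ p^-1 x xN; have := @pfun_lt _ p'^-1 x xN.
case: ifP => ?; case: ifP => ? //; try lia.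
by move=> ? ? /addnI/enum_below_inj; rewrite VCs; lia.
Qed.

End Glue.

Definition last_pattern N s (p : 'S_N) (q : 'S_s) : Prop :=
  forall i j, i < s -> j < s ->
  (pfun p (N - s + i) < pfun p (N - s + j)) = (pfun q i < pfun q j).

Lemma glue_last_pattern N s t (p : 'S_N) (V : {set 'I_(s + t)}) (q : 'S_t) :
  s <= N -> #|V| = t -> last_pattern (glue p V q) q.
Proof.
move=> sN Vt i j il jl; rewrite !pfun_glue //; [|lia..].
rewrite /glue_fun addnK !addKn.
have [-> ->] : (N + i < N) = false /\ (N + j < N) = false by lia.
by rewrite ltn_add2l enum_below_lt_iff // Vt pfun_lt.
Qed.

(** A 4231 that meets the new cell ends in it, so all its values are among
    the [s + t] top ones, and it already occurs in the small permutation formed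
    by the last old cell and the new one. *)
Lemma glue_avoids N s t (p : 'S_N) (r : 'S_s) (V : {set 'I_(s + t)}) (q : 'S_t) :
    s <= N -> #|V| = t -> avoids4231 N (pfun p) -> last_pattern p r ->
    is_domino s t (pfun (glue r V q)) ->
  avoids4231 (N + t) (pfun (glue p V q)).
Proof.
move=> sN Vt av pr [d312 d231 dX].
have ss : s <= s by [].
pose T x := if x < N then pfun r (pfun p^-1 x - (N - s)) else s + (x - N).
have lpi := @pfun_lt _ p^-1; have lr := @pfun_lt _ r.
have Tlt x : x < N + t -> N - s <= pfun (glue p V q) x -> T x < s + t.
  move=> xl; rewrite pfun_glue // /glue_fun /T; case: ifP => [xN | xN]; last by lia.
  by have := lpi x xN; have := lr (pfun p^-1 x - (N - s)); case: ifP; lia.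
have Tval x : x < N + t -> N - s <= pfun (glue p V q) x ->
    pfun (glue r V q) (T x) = pfun (glue p V q) x - (N - s).
  move=> xl xu; rewrite pfun_glue ?Tlt //; move: xu; rewrite pfun_glue //.
  rewrite /glue_fun /T subnn /=; case: ifP => [xN xu | xN _]; last first.
    have -> : (s + (x - N) < s) = false by lia.
    by rewrite addKn add0n addKn.
  case: ifP xu => xs xu; first by lia.
  have xr : pfun p^-1 x - (N - s) < s by have := lpi x xN; lia.
  by rewrite lr // pfunK // subn0 add0n addKn.
have Tmono x y : x < y -> y < N + t -> N - s <= pfun (glue p V q) x ->
    N - s <= pfun (glue p V q) y -> T x < T y.
  move=> xy yl; rewrite !pfun_glue //; last by lia.
  rewrite /glue_fun /T; case: (ltnP y N) => yN; last first.
    have := lpi x; have := lr (pfun p^-1 x - (N - s)).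
    by case: (ltnP x N) => xN; [case: ifP | ]; lia.
  rewrite (ltn_trans xy yN); case: ifP => xs; first by have := lpi x; lia.
  case: ifP => ys; first by have := lpi y; lia.
  move=> _ _; have lx := lpi x (ltn_trans xy yN); have ly := lpi y yN.
  rewrite -pr; [|lia..].
  have -> : N - s + (pfun p^-1 x - (N - s)) = pfun p^-1 x by lia.
  have -> : N - s + (pfun p^-1 y - (N - s)) = pfun p^-1 y by lia.
  by rewrite !pfunVK //; apply: ltn_trans yN.
have small x : x < N -> pfun (glue p V q) x = glue_fun p V q x.
  by move=> xN; rewrite pfun_glue //; lia.
move=> i j k l ij jk kl ll lj jk' ki; case: (ltnP l N) => lN.
  have kN := ltn_trans kl lN; have jN := ltn_trans jk kN; have iN := ltn_trans ij jN.
  (* Inverting a permutation turns 4231 into itself, and interleaving values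
     from above does not change the relative order of the old values. *)
  have le_old x y : x < N -> y < N -> pfun (glue p V q) x < pfun (glue p V q) y ->
      pfun p^-1 x < pfun p^-1 y.
    move=> xN yN; rewrite !small // /glue_fun xN yN /=.
    have lx := lpi x xN; have ly := lpi y yN.
    case: ifP => xs; case: ifP => ys //; try lia.
    have VCs := glue_card_setC Vt.
    by rewrite ltn_add2l enum_below_lt_iff; lia.
  apply: (av (pfun p^-1 l) (pfun p^-1 j) (pfun p^-1 k) (pfun p^-1 i)); rewrite ?pfunVK //;
    try exact: le_old; exact: lpi.
have lu : N - s <= pfun (glue p V q) l.
  by rewrite pfun_glue // /glue_fun ltnNge lN /= leq_addr.
have ju := leq_trans lu (ltnW lj); have ku := leq_trans ju (ltnW jk').
have iu := leq_trans ku (ltnW ki).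
have kl2 := ltn_trans kl ll; have jl2 := ltn_trans jk kl2.
have il2 := ltn_trans ij jl2.
have := Tmono i j ij jl2 iu ju; have := Tmono j k jk kl2 ju ku.
have := Tmono k l kl ll ku lu; have Tl := Tlt l ll lu.
have sl : s <= T l by rewrite /T ltnNge lN /= leq_addr.
have lj' : pfun (glue r V q) (T l) < pfun (glue r V q) (T j).
  by rewrite !Tval //; lia.
have jk2 : pfun (glue r V q) (T j) < pfun (glue r V q) (T k).
  by rewrite !Tval //; lia.
have ki' : pfun (glue r V q) (T k) < pfun (glue r V q) (T i).
  by rewrite !Tval //; lia.
move=> Tkl Tjk Tij.
case: (ltnP (T k) s) => ks; first by apply: (d312 (T i) (T j) (T k)).
case: (ltnP (T j) s) => js; first by apply: (dX (T i) (T j) (T k) (T l)).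
by apply: (d231 (T j) (T k) (T l)) => //; apply: leq_trans js (ltnW _);
  rewrite ?(ltn_trans Tjk).
Qed.

Definition avoids231 t : pred 'S_t := fun q => `[< no231_on t xpredT (pfun q) >].
Arguments avoids231 : clear implicits.

Lemma domino_left231 s t (r : 'S_s) (V : {set 'I_(s + t)}) (q : 'S_t) :
  #|V| = t -> is_domino s t (pfun (glue r V q)) -> avoids231 s r.
Proof.
move=> Vt [d312 _ _]; apply/asboolP => i j k ij jk ks _ _ _ ki ij'.
have js := ltn_trans jk ks; have iS := ltn_trans ij js.
have VCs := glue_card_setC Vt.
have lr := @pfun_lt _ r.
have val x : x < s -> pfun (glue r V q) (pfun r x) = enum_below (~: V) x.
  move=> xs; rewrite pfun_glue //; last by have := lr x xs; lia.
  by rewrite /glue_fun lr //= pfunK // subnn subn0 add0n.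
apply: (d312 (pfun r k) (pfun r i) (pfun r j)); rewrite ?lr ?val //.
  by rewrite enum_below_lt_iff ?VCs.
by rewrite enum_below_lt_iff ?VCs.
Qed.

Lemma domino_right231 s t (r : 'S_s) (V : {set 'I_(s + t)}) (q : 'S_t) :
  #|V| = t -> is_domino s t (pfun (glue r V q)) -> avoids231 t q.
Proof.
move=> Vt [_ d231 _]; apply/asboolP => i j k ij jk ks _ _ _ ki ij'.
have lq := @pfun_lt _ q.
have lt x y : x < t -> y < t -> pfun q x < pfun q y ->
    pfun (glue r V q) (s + x) < pfun (glue r V q) (s + y).
  move=> xt yt xy; have := glue_last_pattern r q (leqnn s) Vt xt yt.
  by rewrite addnK xy.
by apply: (d231 (s + i) (s + j) (s + k)); rewrite ?ltn_add2l ?leq_addr //; apply: lt => //; lia.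
Qed.

(** A 4231 in two horizontally adjacent cells has an inversion in each of them, or
    a 312 in the left one, or a 231 in the right one.  Hence an increasing cell
    interleaves freely with a 231-avoiding one; the binomial coefficients count
    these interleavings. *)
Lemma increasing_left s t (V : {set 'I_(s + t)}) (q : 'S_t) :
  #|V| = t -> avoids231 t q -> is_domino s t (pfun (glue (1 : 'S_s)%g V q)).
Proof.
move=> Vt /asboolP q231.
have VCs := glue_card_setC Vt.
have incr x y : x < y -> y < s ->
    pfun (glue (1 : 'S_s)%g V q) x < pfun (glue (1 : 'S_s)%g V q) y.
  move=> xy ys; rewrite !pfun_glue //; [|lia..].
  rewrite /glue_fun (ltn_trans xy ys) ys /= subnn !ltn0 invg1 !pfun1 !subn0.
  by rewrite enum_below_mono // VCs.
split.
- by move=> i j k ij jk ks _ _ _ + ?; have := incr i k (ltn_trans ij jk) ks; lia.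
- move=> i j k ij jk kl si _ _ ki ij'.
  have sub x : s <= x -> x < s + t -> x = s + (x - s) /\ x - s < t by lia.
  have [|iE iT] := sub i si; first by lia.
  have [| |jE jT] := sub j; [by lia.. |].
  have [| |kE kT] := sub k; [by lia.. |].
  have gp := @glue_last_pattern s s t (1 : 'S_s)%g V q (leqnn s) Vt.
  have := gp (i - s) (j - s) iT jT; have := gp (k - s) (i - s) kT iT.
  rewrite addnK -iE -jE -kE ij' ki => e1 e2.
  by apply: (q231 (i - s) (j - s) (k - s)); rewrite -?e1 -?e2 //; lia.
- by move=> i j k l ij js _ _ _ _ ? ?; have := incr i j ij js; lia.
Qed.

Lemma increasing_right s t (V : {set 'I_(s + t)}) (r : 'S_s) :
  #|V| = t -> avoids231 s r -> is_domino s t (pfun (glue r V (1 : 'S_t)%g)).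
Proof.
move=> Vt /asboolP r231.
have VCs := glue_card_setC Vt.
have incr x y : s <= x -> x < y -> y < s + t ->
    pfun (glue r V (1 : 'S_t)%g) x < pfun (glue r V (1 : 'S_t)%g) y.
  move=> sx xy yt; rewrite !pfun_glue //; [|lia..].
  have [xs ys] : (x < s) = false /\ (y < s) = false by lia.
  by rewrite /glue_fun xs ys !pfun1 ltn_add2l enum_below_lt_iff ?Vt; lia.
have lr := @pfun_lt _ r^-1.
split.
- move=> i j k ij jk ks _ _ _; rewrite !pfun_glue //; [|lia..].
  have js := ltn_trans jk ks; have iS := ltn_trans ij js.
  rewrite /glue_fun ks js iS /= subnn !ltn0 !subn0 !add0n.
  rewrite !enum_below_lt_iff ?VCs ?lr // => jk' ki.
  apply: (r231 (pfun r^-1 j) (pfun r^-1 k) (pfun r^-1 i)); rewrite ?pfunVK ?lr //.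
- by move=> i j k ij jk kt si _ _; have := incr i k; lia.
- by move=> i j k l ij js sk kl lt; have := incr k l sk kl lt; lia.
Qed.


Lemma card_merges s t : #|[pred V : {set 'I_(s + t)} | #|V| == t]| = 'C(s + t, t).
Proof.
have := card_draws 'I_(s + t) t; rewrite card_ord => <-.
by apply: eq_card => V; rewrite !inE.
Qed.

(** Gluing its right cell to the inverse of its left cell yields any domino. *)
Lemma domino_count_le_glue a b :
  domino_count a b <=
  #|[pred u : 'S_a * {set 'I_(a + b)} * 'S_b |
      (#|u.1.2| == b) && domino a b (glue u.1.1 u.1.2 u.2)]|.
Proof.
pose D := [pred u : 'S_a * {set 'I_(a + b)} * 'S_b | #|u.1.2| == b].
pose g (u : 'S_a * {set 'I_(a + b)} * 'S_b) := glue u.1.1 u.1.2 u.2.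
have g_inj : {in D &, injective g}.
  case=> [[r V] q] [[r' V'] q'] /eqP /= Vb /eqP /= V'b.
  by case/(glue_inj (leqnn a) Vb V'b) => /= -> -> ->.
have cardD : #|D| = (a + b)`!.
  have -> : #|D| =
      #|[predX [predX 'S_a & [pred V : {set 'I_(a + b)} | #|V| == b]] & 'S_b]|.
    by apply: eq_card => -[[r V] q]; rewrite !inE /= andbT.
  rewrite !cardX card_merges !card_Sn -(bin_fact (leq_addl a b)) addnK.
  by rewrite [a`! * _]mulnC -mulnA [a`! * _]mulnC.
(* There are as many gluing data as permutations, so gluing is onto. *)
have g_onto (p : 'S_(a + b)) : p \in [seq g u | u in D].
  have /subset_leqif_card[_] : [seq g u | u in D] \subset 'S_(a + b).
    exact: subset_predT.
  by rewrite card_in_image // cardD card_Sn eqxx => /esym/fintype.subsetP; apply.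
rewrite -(card_in_image (f := g)); last first.
  by move=> u v /andP[uD _] /andP[vD _]; apply: g_inj.
apply: subset_leq_card; apply/fintype.subsetP => p dp.
have /fintype.imageP[u uD pE] := g_onto p; rewrite pE.
apply: fintype.image_f; rewrite inE; apply/andP; split=> //.
by rewrite -[glue _ _ _]/(g u) -pE.
Qed.

(** The last [m] positions are the last cell of the chain, which is increasing. *)
Definition chain_perm N m : pred 'S_N :=
  fun p => `[< avoids4231 N (pfun p) /\ last_pattern p (1 : 'S_m)%g >].
Arguments chain_perm : clear implicits.

(** The first binomial coefficient counts the interleavings of the old increasing
    cell with the left cell of a domino, the second one those of the right cell
    of the domino with a new increasing cell. *)
Lemma chain_step N m a b m' : m <= N ->
  #|chain_perm N m| * ('C(m + a, a) * domino_count a b * 'C(b + m', m')) <=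
  #|chain_perm (N + a + b + m') m'|.
Proof.
move=> mN.
pose D := [pred u : 'S_a * {set 'I_(a + b)} * 'S_b |
      (#|u.1.2| == b) && domino a b (glue u.1.1 u.1.2 u.2)].
pose M s t := [pred V : {set 'I_(s + t)} | #|V| == t].
pose f (u : 'S_N * ({set 'I_(m + a)} * ('S_a * {set 'I_(a + b)} * 'S_b) *
    {set 'I_(b + m')})) : 'S_(N + a + b + m') :=
  let: (p, (V1, (r, V2, q), V3)) := u in
  glue (glue (glue p V1 r) V2 q) V3 (1 : 'S_m')%g.
have aN : a <= N + a by exact: leq_addl.
have bN : b <= N + a + b by exact: leq_addl.
apply: (@leq_trans #|[predX chain_perm N m & [predX [predX M m a & D] & M b m']]|).
  rewrite !cardX !card_merges leq_mul2l leq_mul2r leq_mul2l.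
  by rewrite domino_count_le_glue !orbT.
apply: (@leq_card_inj _ _ _ _ f).
  case=> p [[V1 [[r V2] q]] V3] /andP[/= /asboolP[av pat]].
  case/andP=> /andP[/= /eqP V1a /andP[/= /eqP V2b /asboolP dom]] /eqP /= V3m.
  have av1 := glue_avoids mN V1a av pat
    (increasing_left V1a (domino_left231 V2b dom)).
  have av2 := glue_avoids aN V2b av1 (glue_last_pattern p r mN V1a) dom.
  apply/asboolP; split; last exact: glue_last_pattern.
  apply: (glue_avoids bN V3m av2 (glue_last_pattern _ q aN V2b)).
  exact: increasing_right (domino_right231 V2b dom).
case=> p [[V1 [[r V2] q]] V3] [p' [[V1' [[r' V2'] q']] V3']] /andP[_ /= D1] /andP[_ /= D2].
case/andP: D1 => /andP[/= /eqP V1a /andP[/= /eqP V2b _]] /eqP /= V3m.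
case/andP: D2 => /andP[/= /eqP V1a' /andP[/= /eqP V2b' _]] /eqP /= V3m'.
rewrite /f => /(glue_inj bN V3m V3m')[+ -> _].
by move=> /(glue_inj aN V2b V2b')[/(glue_inj mN V1a V1a')[-> -> ->] -> ->].
Qed.

Lemma chain_count a m k :
  (domino_count a a * 'C(a + m, m) ^ 2) ^ k <=
  avoider_count (m + k * (2 * a + m)).
Proof.
pose len k := iter k (fun N => N + a + a + m) m.
have lenE : len k = m + k * (2 * a + m).
  rewrite /len; elim: k => [|k IH]; first by rewrite mul0n addn0.
  by rewrite iterS IH mulSn; lia.
have len_ge j : m <= len j by case: j => //= j; rewrite leq_addl.
have count j : (domino_count a a * 'C(a + m, m) ^ 2) ^ j <= #|chain_perm (len j) m|.
  elim: j => [|j IH].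
    apply/card_gt0P; exists 1%g; apply/asboolP; split.
      by move=> i j k' l; rewrite !pfun1; lia.
    by move=> i j _ _; rewrite !pfun1 subnn.
  apply: leq_trans (@chain_step _ _ a a m (len_ge j)).
  rewrite expnS mulnC; apply: leq_mul => //.
  have -> : 'C(m + a, a) = 'C(a + m, m).
    by rewrite -(bin_sub (leq_addl m a)) addnK addnC.
  by rewrite [X in _ <= X * _]mulnC -mulnA.
rewrite -lenE; apply: leq_trans (count k) _.
by apply: subset_leq_card; apply/fintype.subsetP => p /asboolP[av _]; apply/asboolP.
Qed.

(** * Growing dominoes by inserting maxima *)

(** A domino grows by the insertion of its values in increasing order, each as a
    new maximum of the left or of the right word.  Its stack records, from the
    smallest value to the largest, where maxima may still go.  An item
    [(false, e)] is an open entry [e] of the left word, one in front of which a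
    maximum may come; the open entries form a decreasing suffix of the left word,
    so that no 312 arises.  An item [(true, p)] is a cut of the right word: all
    entries before position [p] are smaller than all entries after it, so that a
    maximum at [p] creates no 231. *)
Definition stack := seq (bool * nat).

Definition open_entries (w : stack) := [seq x.2 | x <- w & ~~ x.1].

Fixpoint keep_low j (w : stack) : stack :=
  match w with
  | [::] => [::]
  | x :: w' => if x.1 then x :: keep_low j w'
               else if j is j'.+1 then x :: keep_low j' w' else keep_low 0 w'
  end.

Definition insert_at n p (s : seq nat) := take p s ++ n :: drop p s.

Definition growth := (seq nat * seq nat * stack)%type.

(** The open entries in front of the new maximum are smaller than it, so they no
    longer belong to a decreasing suffix: only the [j] lowest ones, which come
    behind it, stay open. *)
Definition grow_left n (x : growth) j : growth :=
  let: (l, r, w) := x in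
  (insert_at n (size l - j) l, r, rcons (keep_low j w) (false, n)).

Definition grow_right_end n (x : growth) : growth :=
  let: (l, r, w) := x in (l, rcons r n, rcons w (true, size r)).

(** A maximum [n] put at a cut forms inversions with all the entries behind the
    cut.  From then on an open entry that exceeds one of them must not receive a
    maximum in front of it, as this would complete a 4231, and the cuts above
    have ceased to separate small entries from large ones: everything above the
    cut is removed from the stack. *)
Definition grow_right n (x : growth) k : growth :=
  let: (l, r, w) := x in
  (l, insert_at n (nth (false, 0) w k).2 r, take k.+1 w).

Definition grow n (x : growth) : seq growth :=
  [seq grow_left n x j | j <- iota 0 (size (open_entries x.2)).+1] ++
  grow_right_end n x ::
  [seq grow_right n x k | k <- iota 0 (size x.2) & (nth (false, 0) x.2 k).1].

Arguments grow : simpl never.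

Fixpoint growths n : seq growth :=
  if n is m.+1 then flatten [seq grow m x | x <- growths m]
  else [:: ([::], [::], [::])].

(** Stack items are in the order of their values, where the value of a cut is the
    least entry behind it. *)
Definition before (r : seq nat) (x y : bool * nat) :=
  y.1 ==> if x.1 then x.2 < y.2 else all (ltn x.2) (drop y.2 r).

Record growth_inv n (x : growth) : Prop := GrowthInv {
  growth_size : size x.1.1 + size x.1.2 = n;
  growth_uniq : uniq (x.1.1 ++ x.1.2);
  growth_lt : forall v, v \in x.1.1 ++ x.1.2 -> v < n;
  growth_312 : forall c a b, subseq [:: c; a; b] x.1.1 -> a < b -> b < c -> False;
  growth_231 : forall b c a, subseq [:: b; c; a] x.1.2 -> a < b -> b < c -> False;
  growth_cross : forall d b c a, subseq [:: d; b] x.1.1 -> subseq [:: c; a] x.1.2 ->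
    a < b -> b < c -> c < d -> False;
  growth_suffix : exists l0, x.1.1 = l0 ++ rev (open_entries x.2);
  growth_sorted : sorted ltn (open_entries x.2);
  growth_cut : forall p, (true, p) \in x.2 -> p < size x.1.2 /\
    (forall u v, u \in take p x.1.2 -> v \in drop p x.1.2 -> u < v);
  growth_before : pairwise (before x.1.2) x.2;
  growth_free : forall e c a, e \in open_entries x.2 -> subseq [:: c; a] x.1.2 ->
    a < e -> e < c -> False
}.

Lemma subseq_catP (T : eqType) (s x y : seq T) : subseq s (x ++ y) ->
  exists s1 s2, [/\ s = s1 ++ s2, subseq s1 x & subseq s2 y].
Proof.
case/subseqP => m; rewrite size_cat => m_size ->.
exists (mask (take (size x) m) x), (mask (drop (size x) m) y).
rewrite !mask_subseq -mask_cat ?cat_take_drop //.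
by rewrite size_take m_size; case: ltnP; lia.
Qed.

Lemma subseq_insert n p (s t : seq nat) : subseq t (insert_at n p s) ->
  subseq t s \/
  exists t1 t2, [/\ t = t1 ++ n :: t2, subseq t1 (take p s) & subseq t2 (drop p s)].
Proof.
case/subseq_catP => t1 [[|v t2] [-> sub1]] /=.
  by left; rewrite cats0; apply: subseq_trans sub1 (take_subseq _ _).
case: eqP => [-> sub2 | _ sub2]; [right; by exists t1, t2 | left].
by have := cat_subseq sub1 sub2; rewrite cat_take_drop.
Qed.

Lemma subseq2_insert n p (s : seq nat) c a : subseq [:: c; a] (insert_at n p s) ->
  [\/ subseq [:: c; a] s, c = n /\ a \in drop p s | a = n /\ c \in s].
Proof.
case/subseq_insert => [sub|[t1 [t2 [tE sub1 sub2]]]]; first by apply: Or31.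
case: t1 tE sub1 => [|u [|u' t1]] [].
- by move=> -> t2E _; apply: Or32; rewrite -sub1seq t2E.
- move=> -> -> _ sub1; apply: Or33; split=> //.
  by apply: (mem_take (n0 := p)); rewrite -sub1seq.
- by case: t1.
Qed.

(** When the inserted value is a maximum it can only play the role of the
    largest entry of a pattern. *)
Lemma subseq3_insert n p (s : seq nat) x y z : subseq [:: x; y; z] (insert_at n p s) ->
  [\/ subseq [:: x; y; z] s,
      x = n /\ subseq [:: y; z] (drop p s),
      [/\ y = n, x \in take p s & z \in drop p s]
    | z = n /\ subseq [:: x; y] (take p s)].
Proof.
case/subseq_insert => [sub|[t1 [t2 [tE sub1 sub2]]]]; first by apply: Or41.
case: t1 tE sub1 => [|u [|u' [|u'' t1]]] [].
- by move=> -> t2E _; apply: Or42; rewrite t2E.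
- by move=> -> -> t2E sub1; apply: Or43; rewrite -!sub1seq t2E.
- by move=> -> -> -> _ sub1; apply: Or44.
- by case: t1.
Qed.

Lemma subseq2_mem (u v : nat) (s : seq nat) :
  subseq [:: u; v] s -> u \in s /\ v \in s.
Proof. by move/mem_subseq => sub; split; apply: sub; rewrite !inE eqxx ?orbT. Qed.

Lemma mem_insert n p s v : (v \in insert_at n p s) = (v == n) || (v \in s).
Proof. by rewrite mem_cat inE orbCA -mem_cat cat_take_drop. Qed.

Lemma size_insert n p s : size (insert_at n p s) = (size s).+1.
Proof. by rewrite size_cat /= addnS -size_cat cat_take_drop. Qed.

Lemma perm_insert n p s : perm_eq (insert_at n p s) (n :: s).
Proof. by rewrite perm_catC /= perm_cons perm_catC cat_take_drop. Qed.

Lemma filter_insert n p s : n \notin s -> seq.filter (predC1 n) (insert_at n p s) = s.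
Proof.
move=> ns; rewrite filter_cat /= eqxx -filter_cat cat_take_drop.
by apply/all_filterP/allP => v vs /=; apply: contraNneq ns => <-.
Qed.

Lemma index_insert n p s : n \notin s -> p <= size s -> index n (insert_at n p s) = p.
Proof.
move=> ns ps; rewrite index_cat /= eqxx addn0 size_takel //.
by rewrite (negPf (contraNN (@mem_take _ _ _ _) ns)).
Qed.

Lemma keep_low_subseq j w : subseq (keep_low j w) w.
Proof.
elim: w j => //= x w IH j; case: ifP => _; first by rewrite eqxx.
by case: j => [|j]; rewrite ?eqxx //; apply: subseq_trans (IH 0) (subseq_cons _ _).
Qed.

Lemma open_entries_keep_low j w : open_entries (keep_low j w) = take j (open_entries w).
Proof.
rewrite /open_entries; elim: w j => [|x w IH] [|j] //=; case: ifP => //= xT;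
  by rewrite ?xT /= ?IH ?take0.
Qed.

Lemma keep_low_cat w1 w2 :
  keep_low (size (open_entries w1)) (w1 ++ w2) = w1 ++ seq.filter fst w2.
Proof.
rewrite /open_entries; elim: w1 => [|x w1 IH] /=.
  by elim: w2 => //= x w2 ->; case: ifP.
by case: (x.1) => /=; rewrite IH.
Qed.

Lemma open_entries_rcons w x :
  open_entries (rcons w x) = if x.1 then open_entries w else rcons (open_entries w) x.2.
Proof. by rewrite /open_entries filter_rcons; case: (x.1); rewrite //= map_rcons. Qed.

Lemma mem_open_entries w e : (e \in open_entries w) = ((false, e) \in w).
Proof.
apply/mapP/idP => [[[b v]] | ew].
  by rewrite mem_filter /= => /andP[/negPf/= -> vw] ->.
by exists (false, e); rewrite ?mem_filter.
Qed.

Lemma grow_left_inv n x j : growth_inv n x -> j <= size (open_entries x.2) ->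
  growth_inv n.+1 (grow_left n x j).
Proof.
case: x => [[l r] w] [/= sz un lt l312 r231 cross [l0 lE] srt cut bef free] jl.
set ct := open_entries w in lE srt free jl.
have dropE : drop (size l - j) l = rev (take j ct).
  rewrite lE size_cat size_rev drop_cat.
  have -> : (size l0 + size ct - j < size l0) = false by lia.
  by rewrite drop_rev; congr (rev (take _ _)); lia.
have lt_l v : v \in l -> v < n by move=> vl; apply: lt; rewrite mem_cat vl.
have lt_r v : v \in r -> v < n by move=> vr; apply: lt; rewrite mem_cat vr orbT.
have lt_take v : v \in take (size l - j) l -> v < n by move=> /mem_take/lt_l.
have lt_drop v : v \in drop (size l - j) l -> v < n by move=> /mem_drop/lt_l.
have perm_l : perm_eq (insert_at n (size l - j) l ++ r) (n :: (l ++ r)).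
  by rewrite -cat_cons perm_cat2r perm_insert.
have ctE : open_entries (rcons (keep_low j w) (false, n)) = rcons (take j ct) n.
  by rewrite open_entries_rcons open_entries_keep_low.
have open_lt e : e \in ct -> e < n.
  by move=> ec; apply: lt_l; rewrite lE mem_cat mem_rev ec orbT.
split=> //=.
- by rewrite size_insert addSn sz.
- rewrite (perm_uniq perm_l) /= un andbT; apply/negP => /lt; by rewrite ltnn.
- by move=> v; rewrite (perm_mem perm_l) inE => /predU1P[->|/lt/ltnW].
- move=> c a b /subseq3_insert[/l312 // | [-> sub] | [-> _ /lt_drop] |
    [-> /subseq2_mem[/lt_take]]]; try lia.
  move=> ab _; move: sub; rewrite dropE => /(subseq_sorted (leT := gtn)).
  have -> : sorted gtn (rev (take j ct)) by rewrite rev_sorted take_sorted.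
  by move=> /(_ (fun _ _ _ h1 h2 => ltn_trans h2 h1) isT) /=; lia.
- move=> d b c a /subseq2_insert[/cross|[-> ]|[-> _]]; first exact.
    rewrite dropE mem_rev => /mem_take bct sub ab bc _.
    exact: free bct sub ab bc.
  by move=> /subseq2_mem[/lt_r]; lia.
- by exists (take (size l - j) l); rewrite ctE rev_rcons -dropE.
- rewrite ctE (sorted_pairwise ltn_trans) pairwise_rcons.
  rewrite -(sorted_pairwise ltn_trans) take_sorted // andbT.
  by apply/allP => e /mem_take/open_lt.
- move=> p; rewrite mem_rcons inE => /predU1P[//|/(mem_subseq (keep_low_subseq j w))].
  exact: cut.
- rewrite pairwise_rcons (subseq_pairwise (keep_low_subseq j w)) // andbT.
  by apply/allP.
- move=> e c a; rewrite ctE mem_rcons inE => /predU1P[-> /subseq2_mem[/lt_r]|/mem_take]; first by lia.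
  exact: free.
Qed.

Lemma grow_right_end_inv n x : growth_inv n x -> growth_inv n.+1 (grow_right_end n x).
Proof.
case: x => [[l r] w] [/= sz un lt l312 r231 cross [l0 lE] srt cut bef free].
have lt_r v : v \in r -> v < n by move=> vr; apply: lt; rewrite mem_cat vr orbT.
have lt_l v : v \in l -> v < n by move=> vl; apply: lt; rewrite mem_cat vl.
have rE : rcons r n = insert_at n (size r) r.
  by rewrite /insert_at take_size drop_size cats1.
have sub2 c a : subseq [:: c; a] (rcons r n) -> subseq [:: c; a] r \/ a = n.
  rewrite rE => /subseq2_insert[| [_] |[]]; [by left| by rewrite drop_size | by right].
have ctE : open_entries (rcons w (true, size r)) = open_entries w by rewrite open_entries_rcons.
have open_lt e : e \in open_entries w -> e < n.
  by move=> ec; apply: lt_l; rewrite lE mem_cat mem_rev ec orbT.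
split=> //=.
- by rewrite size_rcons addnS sz.
- rewrite -rcons_cat rcons_uniq un andbT; apply/negP => /lt; by rewrite ltnn.
- by move=> v; rewrite -rcons_cat mem_rcons inE => /predU1P[->|/lt/ltnW].
- move=> b c a; rewrite rE => /subseq3_insert[/r231 //|[_]|[_ _]|[-> sub]];
    rewrite ?drop_size //.
  by move: sub; rewrite take_size => /subseq2_mem[/lt_r]; lia.
- move=> d b c a db /sub2[ca|->]; first exact: cross db ca.
  by have [] := subseq2_mem db => _ /lt_l; lia.
- by exists l0; rewrite ctE.
- by rewrite ctE.
- move=> p; rewrite mem_rcons inE size_rcons => /predU1P[[->]|/cut[pr rcut]].
    split=> // u v; rewrite -cats1 take_size_cat // drop_size_cat // inE.
    by move=> /lt_r ? /eqP->.
  split; first exact: ltnW.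
  move=> u v; rewrite -cats1 drop_cat pr (takel_cat _ (ltnW pr)) mem_cat inE.
  move=> ut /orP[|/eqP->]; first exact: rcut.
  by apply: lt_r; apply: mem_take ut.
- rewrite pairwise_rcons; apply/andP; split.
    apply/allP => -[[] v] vw; rewrite /before /=; first by case: (cut v vw).
    rewrite -cats1 drop_size_cat //= andbT.
    by apply: open_lt; rewrite mem_open_entries.
  apply: (sub_in_pairwise _ (allss w) bef) => -[b u] [[] v] uw vw; rewrite /before //=.
  case: ifP => // /negPf b0; rewrite -cats1 drop_cat.
  case: (cut v vw) => -> _; rewrite all_cat => -> /=; rewrite andbT.
  by apply: open_lt; rewrite mem_open_entries; case: b uw b0.
- move=> e c a; rewrite ctE => ec /sub2[ca|->]; first exact: free ec ca.
  by have := open_lt e ec; lia.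
Qed.

Lemma grow_right_inv n x k : growth_inv n x -> k < size x.2 ->
  (nth (false, 0) x.2 k).1 -> growth_inv n.+1 (grow_right n x k).
Proof.
case: x => [[l r] w] [/= sz un lt l312 r231 cross [l0 lE] srt cut bef free] kl kT.
have [q qE] : exists q, nth (false, 0) w k = (true, q).
  by exists (nth (false, 0) w k).2; case: (nth _ _ _) kT => [[]].
rewrite qE /=; have qw : (true, q) \in w by rewrite -qE mem_nth.
have [q_lt q_cut] := cut q qw.
have takeE : take k.+1 w = rcons (take k w) (true, q) by rewrite (take_nth (false, 0)) ?qE.
have lt_r v : v \in r -> v < n by move=> vr; apply: lt; rewrite mem_cat vr orbT.
have lt_l v : v \in l -> v < n by move=> vl; apply: lt; rewrite mem_cat vl.
have lt_take v : v \in take q r -> v < n by move=> /mem_take/lt_r.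
have lt_drop v : v \in drop q r -> v < n by move=> /mem_drop/lt_r.
have perm_r : perm_eq (l ++ insert_at n q r) (n :: (l ++ r)).
  rewrite (perm_trans (y := l ++ n :: r)) ?perm_cat2l ?perm_insert //.
  by rewrite perm_catC /= perm_cons perm_catC.
have ctE : open_entries (take k.+1 w) = open_entries (take k w) by rewrite takeE open_entries_rcons.
have ct_sub : subseq (open_entries (take k.+1 w)) (open_entries w).
  rewrite -{2}(cat_take_drop k.+1 w) /open_entries filter_cat map_cat.
  exact: prefix_subseq.
(* The entries that stay open lie below the whole part of the right cell that
   the new maximum passes over. *)
have below e v : e \in open_entries (take k.+1 w) -> v \in drop q r -> e < v.
  rewrite ctE mem_open_entries => ew vq.
  have : pairwise (before r) (take k.+1 w) by apply: subseq_pairwise bef; apply: take_subseq.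
  rewrite takeE pairwise_rcons => /andP[/allP/(_ _ ew)] /=.
  by rewrite /before /= => /allP/(_ v vq).
have left_cuts p : (true, p) \in take k.+1 w -> p <= q.
  rewrite takeE mem_rcons inE => /predU1P[[->]//|pw].
  have : pairwise (before r) (take k.+1 w) by apply: subseq_pairwise bef; apply: take_subseq.
  by rewrite takeE pairwise_rcons => /andP[/allP/(_ _ pw)] /= /ltnW.
have drop_mem p v : p <= q -> v \in drop p (insert_at n q r) -> v = n \/ v \in drop p r.
  move=> pq; rewrite /insert_at drop_cat size_takel ?(ltnW q_lt) //.
  have dE : drop p r = drop p (take q r) ++ drop q r.
    rewrite -{1}(cat_take_drop q r) drop_cat size_takel ?(ltnW q_lt) //.
    case: (ltnP p q) => // qp; have -> : p = q by lia.
    by rewrite subnn drop0 [drop q (take _ _)]drop_oversize // size_takel ?(ltnW q_lt).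
  case: ltnP => qp; rewrite dE.
    by rewrite !mem_cat inE orbCA => /predU1P[|]; [left | right].
  have -> : p - q = 0 by lia.
  by rewrite drop0 inE mem_cat => /predU1P[|->]; [left | right; rewrite orbT].
split=> //=.
- by rewrite size_insert addnS sz.
- rewrite (perm_uniq perm_r) /= un andbT; apply/negP => /lt; by rewrite ltnn.
- by move=> v; rewrite (perm_mem perm_r) inE => /predU1P[->|/lt/ltnW].
- move=> b c a /subseq3_insert[/r231 //| [-> sub] | [-> bt ad] | [-> sub]].
  + by have [/lt_drop] := subseq2_mem sub; lia.
  + by have := q_cut _ _ bt ad; lia.
  + by have [/lt_take] := subseq2_mem sub; lia.
- move=> d b c a db /subseq2_insert[ca|[-> _]|[-> /lt_r]]; last by lia.
    exact: cross db ca.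
  by have [] := subseq2_mem db => /lt_l; lia.
- exists (l0 ++ rev (open_entries (drop k.+1 w))).
  rewrite -catA -rev_cat -map_cat -filter_cat cat_take_drop; exact: lE.
- exact: subseq_sorted ltn_trans _ _ ct_sub srt.
- move=> p pw; have pq := left_cuts p pw.
  have [_ p_cut] := cut p (mem_take pw).
  split; first by rewrite size_insert ltnS (leq_trans pq) // ltnW.
  move=> u v; rewrite /insert_at takel_cat ?size_takel ?(ltnW q_lt) //.
  rewrite take_takel // => ut /(drop_mem _ _ pq)[->|]; last exact: p_cut.
  by apply: lt_r; apply: mem_take ut.
- have : pairwise (before r) (take k.+1 w) by apply: subseq_pairwise bef; apply: take_subseq.
  apply: (sub_in_pairwise _ (allss _)) => -[b u] [[] v] uw vw; rewrite /before //=.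
  case: ifP => // /negPf b0 /allP uall.
  apply/allP => y /(drop_mem _ _ (left_cuts v vw))[->|/uall//].
  apply: lt_l; rewrite lE mem_cat mem_rev mem_open_entries.
  by move: (mem_take uw); case: b b0 {uw} => // _ ->; rewrite orbT.
- move=> e c a et /subseq2_insert[|[-> /(below _ _ et) ea] ae|[-> _] ne].
  + by apply: free; apply: (mem_subseq ct_sub).
  + by move: (ltn_trans ea ae); rewrite ltnn.
  move: ne; suff : e < n by lia.
  apply: lt_l; rewrite lE mem_cat mem_rev (mem_subseq ct_sub et) orbT //.
Qed.

Lemma growP n x z : z \in grow n x ->
  [\/ exists2 j, j <= size (open_entries x.2) & z = grow_left n x j,
      z = grow_right_end n x
    | exists k, [/\ k < size x.2, (nth (false, 0) x.2 k).1 & z = grow_right n x k]].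
Proof.
rewrite mem_cat => /orP[/mapP[j] | ].
  by rewrite mem_iota => jl ->; apply: Or31; exists j => //; lia.
rewrite in_cons => /predU1P[-> | /mapP[k]]; first exact: Or32.
rewrite mem_filter mem_iota => /andP[kT kl] ->; apply: Or33; exists k; split=> //; lia.
Qed.

Lemma growths_inv n x : x \in growths n -> growth_inv n x.
Proof.
elim: n x => [|n IH] x.
  by rewrite inE => /eqP ->; split=> //=; exists [::].
move=> /flatten_mapP[y /IH y_inv] /growP[[j jl ->] | -> | [k [kl kT ->]]].
- exact: grow_left_inv.
- exact: grow_right_end_inv.
- exact: grow_right_inv.
Qed.

Lemma uniq_map_inj (T U : eqType) (f : T -> U) (s : seq T) :
  uniq (map f s) -> {in s &, injective f}.
Proof.
elim: s => //= x s IH /andP[fx /IH f_inj] y z.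
rewrite !inE => /predU1P[-> | ys] /predU1P[-> | zs] // fyz; last exact: f_inj.
  by rewrite fyz map_f in fx.
by rewrite -fyz map_f in fx.
Qed.

Lemma uniq_flatten_map (T U : eqType) (F : T -> seq U) (s : seq T) : uniq s ->
  {in s, forall x, uniq (F x)} ->
  {in s &, forall x y z, z \in F x -> z \in F y -> x = y} ->
  uniq (flatten (map F s)).
Proof.
elim: s => //= x s IH /andP[xs us] uF disj; rewrite cat_uniq uF ?mem_head //=.
rewrite IH // => [|y ys|y z ys zs]; last first.
- by apply: disj; rewrite inE ?ys ?zs orbT.
- by apply: uF; rewrite inE ys orbT.
rewrite andbT; apply/hasPn => z /flatten_mapP[y ys zy]; apply/negP => zx.
have xy : x = y by apply: (disj x y _ _ z); rewrite ?inE ?eqxx ?ys ?orbT.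
by rewrite xy ys in xs.
Qed.

(** The place of [n] tells which insertion was made. *)
Lemma uniq_grow n x : growth_inv n x -> uniq (map fst (grow n x)).
Proof.
have [G GE] : exists G, G = map fst (grow n x) by eexists.
rewrite -GE; case: x GE => [[l r] w] GE [/= sz un lt _ _ _ [l0 lE] _ cut bef _].
pose key (z : seq nat * seq nat) : nat + nat :=
  if n \in z.1 then inl (index n z.1) else inr (index n z.2).
have nl : n \notin l by apply/negP => nl; have := lt n; rewrite mem_cat nl ltnn => /(_ isT).
have nr : n \notin r by apply/negP => nr; have := lt n; rewrite mem_cat nr ltnn orbT => /(_ isT).
have ct_size : size (open_entries w) <= size l by rewrite lE size_cat size_rev leq_addl.
pose q k := (nth (false, 0) w k).2.
have qT k : k < size w -> (nth (false, 0) w k).1 -> (true, q k) \in w.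
  move=> kw; rewrite /q; have := mem_nth (false, 0) kw.
  by case: (nth _ _ _) => [[] v].
apply: (@map_uniq _ _ key).
have [I IE] : exists I, I = iota 0 (size (open_entries w)).+1 by eexists.
have -> : map key G =
    map inl [seq size l - j | j <- I] ++
    map inr (size r :: [seq q k | k <- iota 0 (size w) & (nth (false, 0) w k).1]).
  rewrite GE /grow [X in iota 0 X]/= -IE 2!map_cat !map_cons; congr (_ ++ _ :: _).
  - rewrite -!map_comp; apply/eq_in_map => j; rewrite IE mem_iota => jl /=.
    by rewrite /key /= mem_insert eqxx /= index_insert // leq_subr.
  - rewrite /key /= (negPf nl) -cats1 index_cat (negPf nr) /= eqxx addn0 //.
  - rewrite -!map_comp; apply/eq_in_map => k; rewrite mem_filter mem_iota => /andP[kT kl] /=.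
    rewrite /key /= (negPf nl) index_insert //.
    have kw : k < size w by case/andP: kl.
    by case: (cut _ (qT k kw kT)) => /ltnW.
rewrite cat_uniq map_inj_uniq; last by move=> ? ? [].
rewrite [uniq (map inr _)]map_inj_uniq; last by move=> ? ? [].
apply/and3P; split.
- by rewrite IE map_inj_in_uniq ?iota_uniq // => i j; rewrite !mem_iota; lia.
- by apply/hasPn => _ /mapP[v _ ->]; apply/mapP => -[].
rewrite /= map_inj_in_uniq; last first.
  move=> i j; rewrite !mem_filter !mem_iota => /andP[iT il] /andP[jT jl] qij.
  have {}il : i < size w by lia.
  have {}jl : j < size w by lia.
  have mono a b : a < b -> b < size w -> (nth (false, 0) w a).1 ->
      (nth (false, 0) w b).1 -> q a < q b.
    move=> ab bl aT bT; have := pairwiseP (false, 0) bef a b.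
    rewrite !inE (ltn_trans ab bl) bl ab => /(_ isT isT isT).
    by rewrite /before aT bT.
  case: (ltngtP i j) => // [ij | ji].
    by have := mono i j ij jl iT jT; rewrite qij ltnn.
  by have := mono j i ji il jT iT; rewrite qij ltnn.
rewrite filter_uniq ?iota_uniq // andbT; apply/negP => /mapP[k].
rewrite mem_filter mem_iota => /andP[kT kl] qk.
by case: (cut _ (qT k _ kT)) => [|]; rewrite -?qk; lia.
Qed.

(** Deleting the maximum undoes an insertion, so a domino grows in at most one
    way. *)
Lemma uniq_growths n : uniq (map fst (growths n)).
Proof.
elim: n => //= n IH; rewrite map_flatten -map_comp.
apply: uniq_flatten_map => [|x xs|x y xs ys z]; first exact: map_uniq IH.
  exact: uniq_grow (growths_inv xs).
pose strip (z : seq nat * seq nat) :=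
  (seq.filter (predC1 n) z.1, seq.filter (predC1 n) z.2).
have stripE u : u \in growths n -> z \in map fst (grow n u) -> strip z = u.1.
  move=> /growths_inv/growth_lt lt /mapP[v /growP vE ->].
  case: u lt vE => [[l r] w] /= lt vE.
  have nl : n \notin l by apply/negP => nl; have := lt n; rewrite mem_cat nl ltnn => /(_ isT).
  have nr : n \notin r by apply/negP => nr; have := lt n; rewrite mem_cat nr ltnn orbT => /(_ isT).
  have old s : n \notin s -> seq.filter (predC1 n) s = s.
    by move=> ns; apply/all_filterP/allP => v' vs /=; apply: contraNneq ns => <-.
  by case: vE => [[j _ ->] | -> | [k [_ _ ->]]]; rewrite /strip /=
     ?filter_insert ?filter_rcons /= ?eqxx ?old.
move=> zx zy; apply: (uniq_map_inj IH) => //.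
by rewrite -(stripE x) // -(stripE y).
Qed.

Lemma growth_domino n x : growth_inv n x ->
  is_domino (size x.1.1) (size x.1.2) (nth 0 (x.1.1 ++ x.1.2)).
Proof.
case: x => [[l r] w] [/= _ _ _ l312 r231 cross _ _ _ _ _].
have sub2 (s : seq nat) i j : i < j -> j < size s -> subseq [:: nth 0 s i; nth 0 s j] s.
  move=> ij js; rewrite -{3}(cat_take_drop j s) (drop_nth 0 js) -cat1s.
  apply: cat_subseq; last by rewrite /= eqxx sub0seq.
  by rewrite sub1seq -(nth_take 0 ij) mem_nth // size_take js.
have sub3 (s : seq nat) i j k : i < j -> j < k -> k < size s ->
    subseq [:: nth 0 s i; nth 0 s j; nth 0 s k] s.
  move=> ij jk ks; rewrite -{4}(cat_take_drop k s) (drop_nth 0 ks).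
  rewrite -[[:: _; _; _]]/([:: nth 0 s i; nth 0 s j] ++ [:: nth 0 s k]).
  apply: cat_subseq; last by rewrite /= eqxx sub0seq.
  rewrite -(nth_take 0 jk) -(nth_take 0 (ltn_trans ij jk)).
  by apply: sub2 => //; rewrite size_take ks.
have left i : i < size l -> nth 0 (l ++ r) i = nth 0 l i by move=> il; rewrite nth_cat il.
have right i : size l <= i -> nth 0 (l ++ r) i = nth 0 r (i - size l).
  by move=> il; rewrite nth_cat ltnNge il.
split.
- move=> i j k ij jk kl _ _ _; rewrite !left //; try lia.
  exact: l312 (sub3 _ _ _ _ ij jk kl).
- move=> i j k ij jk kl il _ _; rewrite !right //; try lia.
  by apply: r231; apply: sub3; lia.
- move=> i j k l' ij jl lk kl' ll; have il := ltn_trans ij jl.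
  have lk' := leq_trans lk (ltnW kl').
  rewrite (left i) // (left j) // (right k) // (right l') // => lj jk ki.
  by apply: (cross _ _ _ _ (sub2 _ _ _ ij jl) (sub2 _ _ _ _ _) lj jk ki); lia.
Qed.

Lemma count_growths_le n a : a <= n ->
  count (fun x => size x.1.1 == a) (growths n) <= domino_count a (n - a).
Proof.
move=> an; rewrite -(count_map fst (fun z => size z.1 == a)) -size_filter.
pose f (z : seq nat * seq nat) := mkperm (a + (n - a)) (nth 0 (z.1 ++ z.2)).
set s := seq.filter _ _.
have sP (z : seq nat * seq nat) : z \in s ->
    exists2 x, growth_inv n x & z = x.1 /\ size z.1 = a.
  rewrite mem_filter => /andP[/eqP za /mapP[x /growths_inv x_inv zE]].
  by exists x => //; rewrite zE in za *.
have fE (z : seq nat * seq nat) : z \in s ->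
    forall i, i < a + (n - a) -> pfun (f z) i = nth 0 (z.1 ++ z.2) i.
  move=> /sP[x x_inv [zE za]].
  have zs : size (z.1 ++ z.2) = a + (n - a).
    by rewrite size_cat; have := growth_size x_inv; rewrite -zE; lia.
  apply: pfun_mkperm => [i il|i j il jl].
    have /(growth_lt x_inv) : nth 0 (z.1 ++ z.2) i \in x.1.1 ++ x.1.2.
      by rewrite -zE mem_nth // zs.
    lia.
  have un := growth_uniq x_inv; rewrite -zE in un.
  by move/eqP; rewrite nth_uniq ?zs // => /eqP.
have f_inj (z z' : seq nat * seq nat) : z \in s -> z' \in s -> f z = f z' -> z = z'.
  move=> zs zs' ff'.
  have [x x_inv [zE za]] := sP z zs; have [x' x_inv' [zE' za']] := sP z' zs'.
  have sz := growth_size x_inv; have sz' := growth_size x_inv'.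
  rewrite -zE in sz; rewrite -zE' in sz'.
  have : z.1 ++ z.2 = z'.1 ++ z'.2.
    apply: (@eq_from_nth _ 0); first by rewrite !size_cat; lia.
    move=> i; rewrite size_cat => il; rewrite -!fE ?ff' //; lia.
  move/eqP; rewrite eqseq_cat ?za ?za' // => /andP[/eqP e1 /eqP e2].
  by case: z z' e1 e2 {zs zs' ff' zE zE' za za' sz sz'} => z1 z2 [z1' z2'] /= -> ->.
rewrite -(size_map f) /domino_count cardE; apply: uniq_leq_size.
  by rewrite map_inj_in_uniq // filter_uniq // uniq_growths.
move=> _ /mapP[z zs ->]; rewrite mem_enum; apply/asboolP.
have [x x_inv [zE za]] := sP z zs.
have := growth_domino x_inv; rewrite -zE za.
have -> : size z.2 = n - a by rewrite -(growth_size x_inv) -zE za addKn.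
have {}fE := fE z zs.
move=> [d312 d231 dX]; split.
- move=> i j k ij jk kl _ _ _; rewrite !fE; [|lia..].
  exact: (d312 i j k).
- move=> i j k ij jk kl ai _ _; rewrite !fE; [|lia..].
  by apply: (d231 i j k) => //=; lia.
- move=> i j k l ij ja ak kl ll; rewrite !fE; [|lia..].
  exact: (dX i j k l).
Qed.

Lemma size_growths_le n :
  size (growths n) <= \sum_(a < n.+1) domino_count a (n - a).
Proof.
have -> : size (growths n) =
    \sum_(a < n.+1) count (fun x => size x.1.1 == a) (growths n).
  rewrite -[LHS]sum1_size /=.
  rewrite (eq_bigr (fun a : 'I_n.+1 => \sum_(x <- growths n | size x.1.1 == a) 1)); last first.
    by move=> a _; rewrite sum1_count.
  rewrite (exchange_big_dep xpredT) //=; apply: eq_big_seq => x /growths_inv x_inv.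
  have xn : size x.1.1 < n.+1 by rewrite -(growth_size x_inv) ltnS leq_addr.
  rewrite (big_pred1 (Ordinal xn)) //.
by apply: leq_sum => a _; apply: count_growths_le; rewrite -ltnS.
Qed.

(** * Counting growths by their stacks *)

(** Which items of a stack are cuts; only this matters for the number of ways to
    continue. *)
Definition shape (x : growth) : seq bool := map fst x.2.

Definition shape_count n (Q : pred (seq bool)) :=
  count (fun x => Q (shape x)) (growths n).

Definition stack_over (b : seq bool) t : pred (seq bool) :=
  fun s => prefix b s && (count id (drop (size b) s) == t).

Lemma shape_count_step (P Q : pred (seq bool)) n :
  (forall x, P (shape x) -> has (fun z => Q (shape z)) (grow n x)) ->
  shape_count n P <= shape_count n.+1 Q.
Proof.
move=> PQ; rewrite /shape_count /= count_flatten -map_comp.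
elim: (growths n) => //= x s IH; apply: leq_add => //.
by case: (boolP (P (shape x))) => // /PQ; rewrite has_count.
Qed.

Lemma has_grow_left n x j (Q : pred growth) : j <= size (open_entries x.2) ->
  Q (grow_left n x j) -> has Q (grow n x).
Proof.
move=> jl Qj; rewrite /grow has_cat; apply/orP; left; apply/hasP.
by exists (grow_left n x j) => //; apply: map_f; rewrite mem_iota; lia.
Qed.

Lemma has_grow_right_end n x (Q : pred growth) :
  Q (grow_right_end n x) -> has Q (grow n x).
Proof. by move=> Qx; rewrite /grow has_cat [has Q (_ :: _)]/= Qx orbT. Qed.

Lemma has_grow_right n x k (Q : pred growth) : k < size x.2 ->
  (nth (false, 0) x.2 k).1 -> Q (grow_right n x k) -> has Q (grow n x).
Proof.
move=> kl kT Qk; rewrite /grow has_cat; apply/orP; right.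
rewrite [has Q (_ :: _)]/=; apply/orP; right; apply/hasP.
exists (grow_right n x k) => //; apply: map_f.
by rewrite mem_filter kT mem_iota add0n.
Qed.

(** An open entry on top was just inserted: before, the stack had the same cuts
    above [b], interspersed with any open entries, all of which got closed. *)
Lemma shape_count_left n b t :
  shape_count n (stack_over b t) <=
  shape_count n.+1 (pred1 (b ++ rcons (nseq t true) false)).
Proof.
apply: shape_count_step => -[[l r] w] /andP[pre /eqP vt].
have /prefixP[v wE] : prefix b (map fst w) := pre.
rewrite [shape _]wE drop_size_cat // in vt.
have [w1 [w2 [-> w1E w2E]]] : exists w1 w2,
    [/\ w = w1 ++ w2, map fst w1 = b & map fst w2 = v].
  exists (take (size b) w), (drop (size b) w).
  by rewrite cat_take_drop map_take map_drop wE take_size_cat // drop_size_cat.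
apply: (@has_grow_left _ _ (size (open_entries w1))).
  by rewrite /= /open_entries filter_cat map_cat size_cat leq_addr.
rewrite /shape /= map_rcons keep_low_cat map_cat w1E rcons_cat /=.
have -> : map fst (seq.filter fst w2) = nseq t true; last by [].
rewrite -vt -w2E; elim: w2 {w2E} => //= -[[] u] w2 /= -> //.
Qed.

(** A cut on top is either new, or any items above it have just been removed by
    an insertion at this cut. *)
Lemma shape_count_right n b t :
  shape_count n (pred1 (b ++ nseq t true)) +
  shape_count n (prefix (b ++ nseq t.+1 true)) <=
  shape_count n.+1 (pred1 (b ++ nseq t.+1 true)).
Proof.
set P1 := pred1 _; set P2 := prefix _.
have -> : shape_count n P1 + shape_count n P2 = shape_count n (predU P1 P2).
  rewrite -count_predUI [X in _ + X](_ : _ = 0) ?addn0 //.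
  apply/eqP; rewrite -leqn0 leqNgt -has_count; apply/hasPn => x _ /=.
  apply/negP => /andP[/eqP -> /size_prefix].
  by rewrite !size_cat !size_nseq; lia.
apply: shape_count_step => -[[l r] w] /orP[/eqP wE | /prefixP[v wE]].
  apply: has_grow_right_end.
  have -> : shape (grow_right_end n (l, r, w)) = b ++ nseq t.+1 true; last exact: eqxx.
  by rewrite /shape map_rcons [map _ _]wE -cats1 -catA -[[:: _]]/(nseq 1 true) -nseqD addn1.
have {}wE : map fst w = (b ++ nseq t.+1 true) ++ v := wE.
have w_size : size w = size b + t.+1 + size v.
  by rewrite -(size_map fst) wE !size_cat size_nseq.
apply: (@has_grow_right _ _ (size b + t)); rewrite /= ?w_size; first by lia.
  rewrite -(nth_map (false, 0) false fst) ?w_size; last by lia.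
  rewrite wE nth_cat size_cat size_nseq ltn_add2l ltnSn nth_cat addKn nth_nseq ltnSn.
  by rewrite ltnNge leq_addr.
by rewrite /shape /= map_take wE take_size_cat // size_cat size_nseq addnS.
Qed.

Lemma sum_le_one k (F : 'I_k -> nat) m :
  (forall i, F i <= (i == m :> nat)) -> \sum_(i < k) F i <= 1.
Proof.
move=> Fm; apply: (@leq_trans (\sum_(i < k) (i == m :> nat))); first exact: leq_sum.
case: (ltnP m k) => mk.
  rewrite (bigD1 (Ordinal mk)) //= eqxx big1 // => i im.
  by case: eqP => // E; case/eqP: im; apply/val_inj.
by rewrite big1 // => i _; case: eqP => // E; have := ltn_ord i; lia.
Qed.

Local Open Scope ring_scope.

Section WeightedCounts.
Variables (R : realFieldType) (z : R).
Hypothesis z0 : 0 <= z.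

Definition gf N (Q : pred (seq bool)) : R :=
  \sum_(n < N.+1) z ^+ n * (shape_count n Q)%:R.

Lemma gf_ge0 N Q : 0 <= gf N Q.
Proof. by apply: sumr_ge0 => n _; rewrite mulr_ge0 ?exprn_ge0. Qed.

Lemma gf_mono N M Q : (N <= M)%N -> gf N Q <= gf M Q.
Proof.
move=> NM; rewrite /gf (big_ord_widen M.+1 (fun n => z ^+ n * (shape_count n Q)%:R)) //.
rewrite big_mkcond; apply: ler_sum => n _; case: ifP => // _.
by rewrite mulr_ge0 ?exprn_ge0.
Qed.

Lemma gf_sum N k (F : 'I_k -> pred (seq bool)) (Q : pred (seq bool)) :
  (forall s, \sum_(i < k) (F i s : nat) <= Q s)%N ->
  \sum_(i < k) gf N (F i) <= gf N Q.
Proof.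
move=> FQ; rewrite exchange_big /=; apply: ler_sum => n _.
rewrite -mulr_sumr ler_wpM2l ?exprn_ge0 // -natr_sum ler_nat /shape_count.
under eq_bigr do rewrite -sum1_count big_mkcond /=.
rewrite exchange_big -sum1_count [X in (_ <= X)%N]big_mkcond /=.
by apply: leq_sum => x _; have := FQ (shape x); case: (Q _).
Qed.

Lemma gf_step N (f : nat -> nat) Q : (forall n, f n <= shape_count n.+1 Q)%N ->
  z * (\sum_(n < N.+1) z ^+ n * (f n)%:R) <= gf N.+1 Q.
Proof.
move=> PQ; rewrite /gf [X in _ <= X]big_ord_recl mulr_sumr -[X in X <= _]add0r.
apply: lerD; first by rewrite mulr_ge0 ?exprn_ge0.
apply: ler_sum => n _; rewrite mulrA -exprS lift0 ler_wpM2l ?exprn_ge0 //.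
by rewrite ler_nat.
Qed.


Definition run_left (b : seq bool) t := b ++ rcons (nseq t true) false.

Definition run_right (b : seq bool) t := b ++ nseq t true.

(** For a weight [z] per point, [h t] and [a t] bound from below the weighted
    number of ways in which a stack [b] can grow into [b] followed by [t] cuts, or
    into any stack over [b] with [t] cuts above [b], per way in which [b] itself
    can arise.  The delay [c] makes the bounds meaningful for partial sums; it does
    not depend on [b], because nothing below the top of [b] is involved. *)
Definition growth_bounds K (h a : nat -> R) : Prop :=
  exists c, forall t, (t <= K)%N -> forall N b,
  h t * gf N (pred1 b) <= gf (N + c) (pred1 (run_right b t)) /\
  a t * gf N (pred1 b) <= gf (N + c) (stack_over b t).

Lemma prefix_run_left b t s : prefix (run_left b t) s ->
  prefix b s /\ index false (drop (size b) s) = t.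
Proof.
case/prefixP => v ->; rewrite /run_left -!catA prefix_prefix drop_size_cat //.
by split=> //; rewrite cat_rcons index_cat mem_nseq andbF /= addn0 size_nseq.
Qed.

Lemma run_rightP b t : prefix b (run_right b t) /\
  index false (drop (size b) (run_right b t)) = t.
Proof.
rewrite prefix_prefix drop_size_cat //; split=> //.
by rewrite -[nseq t true]cats0 index_cat mem_nseq andbF /= size_nseq addn0.
Qed.

Lemma prefix_run_right_false b t : ~~ prefix (run_left b t) (run_right b t).
Proof.
apply/negP => /size_prefix; rewrite !size_cat size_rcons !size_nseq; lia.
Qed.

Lemma gf_prefix N K b :
  \sum_(i < K.+1) gf N (stack_over b i) <= gf N (prefix b).
Proof.
apply: gf_sum => s; case: (boolP (prefix b s)) => bs; last first.
  by rewrite big1 // => i _; rewrite /stack_over (negPf bs).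
apply: (@sum_le_one _ _ (count id (drop (size b) s))) => i.
by rewrite /stack_over bs eq_sym.
Qed.

(** Decomposition at the lowest open entry above [b]. *)
Lemma gf_stack_over N b t :
  gf N (pred1 (run_right b t)) +
    \sum_(i < t.+1) gf N (stack_over (run_left b i) (t - i)%N) <=
  gf N (stack_over b t).
Proof.
pose F (i : 'I_t.+1) : pred (seq bool) := fun s =>
  (i == t :> nat) && (s == run_right b t) || stack_over (run_left b i) (t - i)%N s.
apply: (@le_trans _ _ (\sum_(i < t.+1) gf N (F i))); last first.
  apply: gf_sum => s; case: (boolP (stack_over b t s)) => bs.
    apply: (@sum_le_one _ _ (index false (drop (size b) s))) => i.
    rewrite /F; case: eqP => [-> | _] /=; last first.
      by case: (boolP (stack_over _ _ _)) => // /andP[/prefix_run_left[_ ->]]; rewrite eqxx.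
    case: eqP => [-> | _] /=; first by have [_ ->] := run_rightP b t; rewrite eqxx.
    by case: (boolP (stack_over _ _ _)) => // /andP[/prefix_run_left[_ ->]]; rewrite eqxx.
  rewrite big1 // => i _; apply/eqP; rewrite eqb0; apply: contra bs.
  have it : (i <= t)%N by rewrite -ltnS.
  rewrite /F => /orP[/andP[_ /eqP->] | /andP[/prefixP[v ->]]].
    rewrite /stack_over /run_right prefix_prefix drop_size_cat //.
    by rewrite count_nseq mul1n eqxx.
  rewrite /stack_over drop_size_cat // /run_left -!catA prefix_prefix drop_size_cat //.
  rewrite count_cat -cats1 count_cat count_nseq /= mul1n addn0 => /eqP ->.
  by rewrite addn0 subnKC.
rewrite big_ord_recr [X in _ <= X]big_ord_recr /= addrCA.
have le_F (i : 'I_t.+1) : gf N (stack_over (run_left b i) (t - i)%N) <= gf N (F i).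
  apply: ler_sum => n _; rewrite ler_wpM2l ?exprn_ge0 // ler_nat.
  by apply: sub_count => x; rewrite /F => /= ->; rewrite orbT.
apply: lerD; first by apply: ler_sum => i _; apply: (le_F (widen_ord _ i)).
rewrite /gf -big_split; apply: ler_sum => n _ /=.
rewrite -mulrDr ler_wpM2l ?exprn_ge0 // -natrD ler_nat /shape_count.
rewrite -count_predUI [X in (_ + X <= _)%N](_ : _ = 0%N) ?addn0.
  by apply: sub_count => x; rewrite /F /= eqxx.
apply/eqP; rewrite -leqn0 leqNgt -has_count; apply/hasPn => x _ /=.
by apply/negP => /andP[/eqP -> /andP[]]; rewrite (negPf (prefix_run_right_false _ _)).
Qed.

(** Decomposition at the lowest open entry above the run of cuts. *)
Lemma gf_prefix_run N K b t : (t <= K.+1)%N ->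
  \sum_(t <= k < K.+1)
    (gf N (pred1 (run_right b k)) + gf N (prefix (run_left b k))) <=
  gf N (prefix (run_right b t)).
Proof.
move=> tK.
pose F (i : 'I_(K.+1 - t)) : pred (seq bool) := fun s =>
  (s == run_right b (i + t)) || prefix (run_left b (i + t)) s.
apply: (@le_trans _ _ (\sum_(i < K.+1 - t) gf N (F i))); last first.
  apply: gf_sum => s; case: (boolP (prefix (run_right b t) s)) => bs.
    apply: (@sum_le_one _ _ (index false (drop (size b) s) - t)) => i.
    rewrite /F; case: eqP => [-> | _] /=.
      by have [_ ->] := run_rightP b (i + t); rewrite addnK eqxx.
    by case: (boolP (prefix _ _)) => // /prefix_run_left[_ ->]; rewrite addnK eqxx.
  rewrite big1 // => i _; apply/eqP; rewrite eqb0; apply: contra bs.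
  have runE : run_right b (i + t) = run_right b t ++ nseq i true.
    by rewrite /run_right -catA -nseqD addnC.
  rewrite /F => /orP[/eqP -> | /prefixP[v ->]]; rewrite ?runE ?prefix_prefix //.
  rewrite /run_left -cats1 catA -/(run_right b (i + t)) runE; apply/prefixP.
  by exists (nseq i true ++ [:: false] ++ v); rewrite !catA.
rewrite -{1}[t]add0n big_addn big_mkord; apply: ler_sum => i _.
rewrite /gf -big_split; apply: ler_sum => n _ /=.
rewrite -mulrDr ler_wpM2l ?exprn_ge0 // -natrD ler_nat /shape_count.
rewrite -count_predUI [X in (_ + X <= _)%N](_ : _ = 0%N) ?addn0.
  by apply: sub_count => x.
apply/eqP; rewrite -leqn0 leqNgt -has_count; apply/hasPn => x _ /=.
by apply/negP => /andP[/eqP ->]; rewrite (negPf (prefix_run_right_false _ _)).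
Qed.

(** The generating functions of which [h] and [a] are lower bounds satisfy the
    equations [h = next_h h a] and [a = next_a h a] for [K] infinite; both are
    read off from the last insertion. *)
Definition next_h K (h a : nat -> R) t : R :=
  if t is s.+1 then
    z * (h s + \sum_(t <= k < K.+1) (h k + z * (\sum_(i < K.+1) a i) * a k))
  else 1.

Definition next_a (h a : nat -> R) t : R :=
  h t + z * \sum_(i < t.+1) a i * a (t - i)%N.

(** Each bound for [t] cuts comes from undoing one insertion, which leads to a
    stack that grows over [b] in one or two independent steps; hence the products
    of two bounds. *)
Lemma growth_bounds_next K h a : (forall t, (t <= K)%N -> 0 <= a t) ->
  growth_bounds K h a -> growth_bounds K (next_h K h a) (next_a h a).
Proof.
move=> a0 [c bounds]; exists (c + c).+2 => t tK N b.
set g := gf N (pred1 b); have g0 : 0 <= g by exact: gf_ge0.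
have left_bound k M : (k <= K)%N -> (N + c < M)%N ->
    z * a k * g <= gf M (pred1 (run_left b k)).
  move=> kK NM; apply: le_trans (gf_mono _ NM); rewrite -mulrA.
  have [_ ak] := bounds k kK N b.
  apply: le_trans (ler_wpM2l z0 ak) _.
  exact: (@gf_step _ (fun n => shape_count n (stack_over b k)) _
    (fun n => shape_count_left n b k)).
split.
  case: t tK => [|t] tK.
    by rewrite /= mul1r /run_right cats0; apply: gf_mono; lia.
  rewrite /next_h; set W := \sum_(i < _) _.
  have W0 : 0 <= W by apply: sumr_ge0 => i _; apply: a0; rewrite -ltnS.
  have right_bound k M : (k <= K)%N -> (N + c <= M)%N ->
      h k * g <= gf M (pred1 (run_right b k)).
    move=> kK NM; apply: le_trans (gf_mono _ NM).
    by have [] := bounds k kK N b.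
  have prefix_bound k : (k <= K)%N ->
      z * W * a k * g <= gf (N + (c + c).+1) (prefix (run_left b k)).
    move=> kK; apply: le_trans (gf_prefix _ K _).
    apply: (@le_trans _ _ (W * gf (N + c).+1 (pred1 (run_left b k)))).
      by rewrite -[z * W]mulrC -!mulrA ler_wpM2l // mulrA left_bound.
    rewrite mulr_suml; apply: ler_sum => i _.
    have -> : (N + (c + c).+1 = (N + c).+1 + c)%N by lia.
    have iK : (i <= K)%N by rewrite -ltnS.
    by have [_] := bounds i iK (N + c).+1 (run_left b k).
  rewrite -mulrA addnS.
  set M := (N + (c + c).+1)%N.
  apply: le_trans (@gf_step M _ _ (fun n => shape_count_right n b t)).
  rewrite ler_wpM2l //.
  have -> : \sum_(n < M.+1) z ^+ n * (shape_count n (pred1 (b ++ nseq t true)) +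
      shape_count n (prefix (b ++ nseq t.+1 true)))%:R =
    gf M (pred1 (run_right b t)) + gf M (prefix (run_right b t.+1)).
    by rewrite /gf -big_split; apply: eq_bigr => n _; rewrite natrD mulrDr.
  rewrite mulrDl; apply: lerD; first by apply: right_bound; lia.
  apply: (le_trans _ (@gf_prefix_run M K b t.+1 _)); last by lia.
  rewrite mulr_suml !big_nat; apply: ler_sum => k /andP[_ kK].
  by rewrite mulrDl; apply: lerD; [apply: right_bound | apply: prefix_bound]; lia.
apply: le_trans (gf_stack_over _ _ _).
rewrite /next_a mulrDl; apply: lerD.
  have NM : (N + c <= N + (c + c).+2)%N by lia.
  by apply: le_trans (gf_mono _ NM); have [] := bounds t tK N b.
rewrite -mulrA mulr_suml mulr_sumr; apply: ler_sum => i _.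
have it : (i <= t)%N by rewrite -ltnS.
have iK : (i <= K)%N by lia.
have tiK : (t - i <= K)%N by lia.
have NM : ((N + c).+1 + c <= N + (c + c).+2)%N by lia.
apply: le_trans (gf_mono _ NM).
have [_] := bounds (t - i)%N tiK (N + c).+1 (run_left b i).
apply: le_trans.
have -> : z * (a i * a (t - i)%N * g) = a (t - i)%N * (z * a i * g) by ring.
by rewrite ler_wpM2l ?a0 // left_bound.
Qed.

Lemma growth_bounds_start K : growth_bounds K (fun t => (t == 0)%:R) (fun=> 0).
Proof.
exists 0%N => t _ N b; rewrite addn0 mul0r gf_ge0; split=> //.
case: t => [|t] /=; last by rewrite mul0r gf_ge0.
by rewrite mul1r /run_right cats0.
Qed.

Lemma growth_bounds_weaken K h a h' a' : growth_bounds K h a ->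
  (forall t, (t <= K)%N -> h' t <= h t) -> (forall t, (t <= K)%N -> a' t <= a t) ->
  growth_bounds K h' a'.
Proof.
move=> [c bounds] hh aa; exists c => t tK N b; have [ht at_] := bounds t tK N b.
by split; [apply: le_trans ht | apply: le_trans at_];
  rewrite ler_wpM2r ?gf_ge0 ?hh ?aa.
Qed.

Lemma growth_bounds_total K h a : growth_bounds K h a ->
  exists N, \sum_(i < K.+1) a i <= \sum_(n < N.+1) z ^+ n * (size (growths n))%:R.
Proof.
move=> [c bounds]; exists c; apply: (@le_trans _ _ (gf c (prefix [::]))).
  apply: le_trans (gf_prefix c K [::]); apply: ler_sum => i _.
  have iK : (i <= K)%N by rewrite -ltnS.
  have [_] := bounds i iK 0%N [::].
  by rewrite add0n /gf big_ord_recl big_ord0 expr0 mul1r addr0 /= mulr1.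
apply: ler_sum => n _; rewrite ler_wpM2l ?exprn_ge0 // ler_nat.
exact: count_size.
Qed.

End WeightedCounts.

(** ** Iterating the bounds in fixed-point arithmetic *)

Definition sumN (f : nat -> N) m n : N := foldr N.add 0%num [seq f k | k <- iota m n].

(** One round of the bounds at [z = 20 / 127], in integers that stand for
    multiples of [1 / scale] and are rounded down. *)
Definition round (scale : N) (K : nat) (ha : seq N * seq N) : seq N * seq N :=
  let h := nth 0%num ha.1 in let a := nth 0%num ha.2 in
  let W := sumN a 0 K.+1 in
  (mkseq (fun t => if t is s.+1 then
      N.div (20 * (127 * scale * (h s + sumN h t (K.+1 - t)) + 20 * W * sumN a t (K.+1 - t)))
            (127 * 127 * scale)
      else scale)%num K.+1,
   mkseq (fun t => h t + N.div (20 * sumN (fun i => a i * a (t - i)%N) 0 t.+1)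
            (127 * scale))%num K.+1).

Definition rounds scale K j := iter j (round scale K) ([:: scale], [::]).

Section FixedPoint.
Variables (R : realFieldType) (scale : N).
Hypothesis scale_neq0 : scale <> 0%num.

Definition valN (x : N) : R := (N.to_nat x)%:R.
Definition fixed (x : N) : R := valN x / valN scale.

Lemma valN_ge0 x : 0 <= valN x. Proof. exact: ler0n. Qed.
Lemma valND x y : valN (x + y)%num = valN x + valN y.
Proof. by rewrite /valN N2Nat.inj_add natrD. Qed.
Lemma valNM x y : valN (x * y)%num = valN x * valN y.
Proof. by rewrite /valN N2Nat.inj_mul natrM. Qed.

Lemma valN_div x y : 0 < valN y -> valN (N.div x y) <= valN x / valN y.
Proof.
move=> y0; rewrite ler_pdivlMr // -valNM ler_nat.
have yn0 : y <> 0%num by move=> yE; rewrite yE /valN ltxx in y0.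
have := N.Div0.mul_div_le x y; lia.
Qed.

Lemma valN_sum f m n : valN (sumN f m n) = \sum_(m <= k < m + n) valN (f k).
Proof.
rewrite /sumN; elim: n m => [|n IH] m; first by rewrite addn0 big_geq.
by rewrite /= valND IH big_ltn ?addSnnS //; lia.
Qed.

Lemma scale_gt0 : 0 < valN scale.
Proof. by rewrite /valN ltr0n; lia. Qed.

Lemma round_bounds K ha :
  growth_bounds (20 / 127 : R) K (fun t => fixed (nth 0%num ha.1 t))
    (fun t => fixed (nth 0%num ha.2 t)) ->
  growth_bounds (20 / 127 : R) K (fun t => fixed (nth 0%num (round scale K ha).1 t))
    (fun t => fixed (nth 0%num (round scale K ha).2 t)).
Proof.
have S0 := scale_gt0; have Sn0 : valN scale != 0 by rewrite gt_eqF.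
have e20 : valN 20 = 20%:R by [].
have e127 : valN 127 = 127%:R by [].
have z0 : 0 <= 20 / 127 :> R by lra.
move=> bounds.
have a0 t : (t <= K)%N -> 0 <= fixed (nth 0%num ha.2 t).
  by move=> _; rewrite divr_ge0 ?valN_ge0.
apply: growth_bounds_weaken (growth_bounds_next z0 a0 bounds) _ _ => // t tK.
  rewrite /round [nth _ (_, _).1 _]nth_mkseq ?ltnS //.
  case: t tK => [|t] tK; first by rewrite /next_h /fixed divff.
  rewrite /next_h /fixed ler_pdivrMr //.
  apply: le_trans (valN_div _ _) _; first by rewrite !valNM e127; lra.
  rewrite valNM valND !valNM valND !valN_sum e127 e20 subnKC; last by lia.
  rewrite big_split /= -mulr_sumr -!mulr_suml.
  rewrite le_eqVlt; apply/orP; left; apply/eqP.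
  rewrite add0n big_mkord.
  by field.
rewrite /round [nth _ (_, _).2 _]nth_mkseq ?ltnS //.
rewrite /next_a /fixed valND mulrDl lerD2l ler_pdivrMr //.
apply: le_trans (valN_div _ _) _; first by rewrite !valNM e127; lra.
rewrite !valNM !valN_sum e127 e20 add0n big_mkord.
under eq_bigr do rewrite valNM.
have -> : \sum_(i < t.+1) valN (nth 0%num ha.2 i) / valN scale *
    (valN (nth 0%num ha.2 (t - i)) / valN scale) =
   (\sum_(i < t.+1) valN (nth 0%num ha.2 i) * valN (nth 0%num ha.2 (t - i))) /
     (valN scale * valN scale).
  by rewrite mulr_suml; apply: eq_bigr => i _; field.
by rewrite le_eqVlt; apply/orP; left; apply/eqP; field.
Qed.

Lemma rounds_bounds K j :
  growth_bounds (20 / 127 : R) K (fun t => fixed (nth 0%num (rounds scale K j).1 t))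
    (fun t => fixed (nth 0%num (rounds scale K j).2 t)).
Proof.
elim: j => [|j IH]; last exact: round_bounds.
have z0 : 0 <= 20 / 127 :> R by lra.
apply: growth_bounds_weaken (growth_bounds_start z0 K) _ _ => // -[|t] _ /=.
- by rewrite /fixed divff // gt_eqF // scale_gt0.
- by rewrite nth_nil /fixed mul0r.
- by rewrite /fixed mul0r.
- by rewrite /fixed mul0r.
Qed.

Lemma weighted_growths_ge K j M :
  (M * scale <=? sumN (nth 0%num (rounds scale K j).2) 0 K.+1)%num ->
  exists N, valN M <= \sum_(n < N.+1) (20 / 127 : R) ^+ n * (size (growths n))%:R.
Proof.
move=> large.
have z0 : 0 <= 20 / 127 :> R by lra.
have [N W_le] := growth_bounds_total z0 (rounds_bounds K j).
exists N; apply: le_trans W_le.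
rewrite -mulr_suml ler_pdivlMr ?scale_gt0 // -valNM.
rewrite -(big_mkord xpredT (fun i => valN (nth 0%num (rounds scale K j).2 i))).
have := valN_sum (nth 0%num (rounds scale K j).2) 0 K.+1; rewrite add0n => <-.
rewrite ler_nat; move/N.leb_le: large; lia.
Qed.

End FixedPoint.

(** The radius of convergence is less than [20 / 127], even for the equations
    restricted to at most ten cuts, so the iterates pass any bound; 62 rounds
    suffice to pass the one that is needed. *)
Lemma weighted_growths_large (R : realFieldType) :
  exists N, 20 * 1000 <= \sum_(n < N.+1) (20 / 127 : R) ^+ n * (size (growths n))%:R.
Proof.
have D0 : 100000%num <> 0%num by [].
have large : (20 * 1000 * 100000 <=? sumN (nth 0%num (rounds 100000 10 62).2) 0 11)%num.
  by vm_compute.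
by have [N] := weighted_growths_ge R D0 large; rewrite valNM; exists N.
Qed.

Local Open Scope classical_set_scope.

(** * Growth rates *)

Lemma bernoulli (R : realType) (x : R) n : 1 <= x -> 1 + n%:R * (x - 1) <= x ^+ n.
Proof.
move=> x1; elim: n => [|n IH]; first by rewrite mul0r addr0 expr0.
rewrite exprS; apply: le_trans (_ : x * (1 + n%:R * (x - 1)) <= _); last first.
  by rewrite ler_wpM2l //; lra.
have n0 : 0 <= n%:R :> R by [].
have : 0 <= n%:R * (x - 1) ^+ 2 by rewrite mulr_ge0 ?sqr_ge0.
rewrite -natr1; nra.
Qed.

Lemma natr_unbounded (R : realType) (x : R) : exists n, x < n%:R.
Proof.
exists (Num.bound `|x|).
exact: le_lt_trans (ler_norm x) (archi_boundP (normr_ge0 x)).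
Qed.

Section Fekete.
Variables (R : realType) (s : nat -> R) (C : R).
Hypotheses (s_ge1 : forall n, 1 <= s n) (s_le : forall n, s n <= C ^+ n)
  (s_super : forall m n, s m * s n <= s (m + n)%N).

Let u n : R := s n `^ n%:R^-1.

Let s_gt0 n : 0 < s n. Proof. exact: lt_le_trans ltr01 (s_ge1 n). Qed.

Let C_ge1 : 1 <= C.
Proof. by apply: le_trans (s_ge1 1) _; rewrite -[C]expr1. Qed.

Let C_ge0 : 0 <= C. Proof. exact: le_trans ler01 C_ge1. Qed.

Let u_expr n : (0 < n)%N -> u n ^+ n = s n.
Proof.
move=> n0; rewrite -powR_mulrn ?powR_ge0 // /u -powRrM mulVf ?pnatr_eq0 -?lt0n //.
by rewrite powRr1 // ltW.
Qed.

Let s_expr m q : s m ^+ q <= s (q * m)%N.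
Proof.
elim: q => [|q IH]; first by rewrite expr0.
rewrite exprS mulSn; apply: le_trans (s_super m (q * m)).
by rewrite ler_wpM2l // ltW.
Qed.

(** The limit is the supremum [S] of the [s n `^ n%:R^-1]: when [b] is such a root
    close to [S], say for the index [m], then [s n] is at least [b ^+ n] up to a
    factor [b ^+ m], for all [n], by supermultiplicativity. *)
Lemma fekete : exists L : R,
  s n `^ n%:R^-1 @[n --> \oo] --> L /\ forall n, s n <= L ^+ n.
Proof.
pose E := [set u n.+1 | n in [set: nat]].
have u_le n : (0 < n)%N -> u n <= C.
  move=> n0; rewrite -(@ler_pXn2r _ n) ?nnegrE ?powR_ge0 //.
  by rewrite u_expr.
have E_sup : has_sup E.
  split; first by exists (u 1), 0%N.
  by exists C => _ [n _ <-]; apply: u_le.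
have u_sup n : (0 < n)%N -> u n <= sup E.
  by case: n => // n _; apply: ub_le_sup; [case: E_sup | exists n].
have u_ge1 n : (0 < n)%N -> 1 <= u n.
  move=> n0; rewrite -(@ler_pXn2r _ n) ?nnegrE ?powR_ge0 // u_expr // expr1n.
  exact: s_ge1.
exists (sup E); split; last first.
  case=> [|n]; first by apply: le_trans (s_le 0) _; rewrite !expr0.
  rewrite -u_expr // ler_pXn2r ?nnegrE ?powR_ge0 ?u_sup //.
  exact: le_trans (powR_ge0 _ _) (u_sup 1%N isT).
apply/cvgrPdist_lt => e e0.
have [_ [m _ <-] um] := sup_adherent e0 E_sup.
set b := u m.+1 in um; have b1 : 1 <= b by exact: u_ge1.
(* The maximum with 1 / 2 keeps [c] positive, hence its powers comparable. *)
pose c := Num.max (sup E - e) (1 / 2).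
have c0 : 0 < c by rewrite lt_max; apply/orP; right; lra.
have cb : c < b by rewrite gt_max um /=; lra.
have bc1 : 1 < b / c by rewrite ltr_pdivlMr ?mul1r.
have [n0 n0_gt] := natr_unbounded (b ^+ m.+1 / (b / c - 1)).
near=> n.
have n_gt0 : (0 < n)%N by near: n; exact: nbhs_infty_gt.
have n0n : (n0 <= n)%N by near: n; exact: nbhs_infty_ge.
have un := u_sup n n_gt0.
suff cu : c < u n.
  have : sup E - e < u n by apply: le_lt_trans cu; rewrite le_max lexx.
  by rewrite -/(u n) ger0_norm ?subr_ge0 //; lra.
rewrite ltNge; apply/negP => uc.
have sn_lower : b ^+ n <= b ^+ m.+1 * s n.
  have sq : b ^+ (n %/ m.+1 * m.+1) <= s n.
    rewrite mulnC exprM u_expr //; apply: le_trans (s_expr _ _) _.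
    rewrite [in X in _ <= X](divn_eq n m.+1); apply: le_trans (s_super _ _).
    by rewrite ler_peMr // ltW.
  have b0 : 0 <= b by lra.
  rewrite {1}(divn_eq n m.+1) exprD mulrC ler_pM ?exprn_ge0 //.
  by rewrite ler_weXn2l // ltnW // ltn_pmod.
have : (b / c) ^+ n <= b ^+ m.+1.
  rewrite expr_div_n ler_pdivrMr ?exprn_gt0 //; apply: le_trans sn_lower _.
  rewrite ler_wpM2l ?exprn_ge0 //; first by lra.
  by rewrite -u_expr // ler_pXn2r ?nnegrE ?powR_ge0 // ltW.
have := bernoulli n (ltW bc1).
have : b ^+ m.+1 < n%:R * (b / c - 1).
  rewrite -ltr_pdivrMr ?subr_gt0 //; apply: lt_le_trans n0_gt _.
  by rewrite ler_nat.
by lra.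
Unshelve. all: end_near.
Qed.

End Fekete.

(** Polynomial factors do not affect growth rates; a quadratic one is all that
    the squared binomial coefficients need. *)
Lemma expr_le_poly (R : realType) (x y C : R) : 0 <= x -> 0 <= y -> 0 <= C ->
  (forall k, x ^+ k <= C * k.+1%:R ^+ 2 * y ^+ k) -> x <= y.
Proof.
move=> x0 y0 C0 xy; rewrite leNgt; apply/negP => yx.
have [yE|] := eqVneq y 0.
  by have := xy 1%N; rewrite yE expr0n !expr1 mulr0; lra.
move=> yn0; have {y0 yn0} y0 : 0 < y by rewrite lt_def yn0.
pose d := x / y - 1.
have d0 : 0 < d by rewrite subr_gt0 ltr_pdivlMr ?mul1r.
(* The cube of Bernoulli's inequality outgrows the quadratic factor. *)
have [n n_gt] := natr_unbounded (16 * C / d ^+ 3).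
pose i := n.+1; pose t := i%:R : R.
have t1 : 1 <= t by rewrite ler1n.
have big : 16 * C < t * d ^+ 3.
  rewrite -ltr_pdivrMr ?exprn_gt0 //; apply: lt_le_trans n_gt _.
  by rewrite ler_nat.
have low : (t * d) ^+ 3 <= (x / y) ^+ (3 * i).
  have xy0 : 0 <= x / y by rewrite divr_ge0 // ltW.
  have td0 : 0 <= t * d by rewrite mulr_ge0; lra.
  rewrite mulnC exprM ler_pXn2r ?nnegrE ?exprn_ge0 //.
  have := @bernoulli _ (x / y) i; rewrite -/d -/t => b.
  by apply: le_trans (b _); [lra | rewrite /d in d0; lra].
have up : (x / y) ^+ (3 * i) <= C * (3 * i).+1%:R ^+ 2.
  by rewrite expr_div_n ler_pdivrMr ?exprn_gt0.
have e : (3 * i).+1%:R = 3 * t + 1 :> R by rewrite -natr1 natrM.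
have le16 : C * (3 * t + 1) ^+ 2 <= C * (16 * t ^+ 2).
  by rewrite ler_wpM2l //; nra.
have : t ^+ 2 * (16 * C) < t ^+ 2 * (t * d ^+ 3).
  by rewrite ltr_pM2l // exprn_gt0 //; lra.
have : (t * d) ^+ 3 = t ^+ 2 * (t * d ^+ 3) by ring.
move: up; rewrite e => up.
have : C * (16 * t ^+ 2) = t ^+ 2 * (16 * C) by ring.
by lra.
Qed.

(** This binomial coefficient belongs to the largest of the [3 * q + 1] terms of
    the expansion of [(1 / 3 + 2 / 3) ^ (3 * q)]. *)
Lemma bin3_lower q : (27 ^ q <= 4 ^ q * (3 * q).+1 * 'C(3 * q, q))%N.
Proof.
elim: q => // q IH.
have rec : ('C(3 * q.+1, q.+1) * (q.+1 * (2 * q).+2 * (2 * q).+1) =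
    (3 * q).+3 * (3 * q).+2 * (3 * q).+1 * 'C(3 * q, q))%N.
  have -> : (3 * q.+1 = (3 * q).+3)%N by lia.
  have e1 := mul_bin_diag (3 * q).+3 q.
  have e2 := mul_bin_down (3 * q).+2 q.
  have e3 := mul_bin_down (3 * q).+1 q.
  rewrite /= in e1 e2 e3.
  have f2 : ((3 * q).+2 - q = (2 * q).+2)%N by lia.
  have f3 : ((3 * q).+1 - q = (2 * q).+1)%N by lia.
  rewrite f2 in e2; rewrite f3 in e3.
  transitivity (q.+1 * 'C((3 * q).+3, q.+1) * ((2 * q).+2 * (2 * q).+1))%N; first by ring.
  rewrite -e1; transitivity ((3 * q).+3 * ((2 * q).+2 * 'C((3 * q).+2, q)) * (2 * q).+1)%N.
    by ring.
  rewrite -e2; transitivity ((3 * q).+3 * (3 * q).+2 * ((2 * q).+1 * 'C((3 * q).+1, q)))%N.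
    by ring.
  by rewrite -e3; ring.
rewrite -(@leq_pmul2r (q.+1 * (2 * q).+2 * (2 * q).+1)) // -[X in (_ <= X)%N]mulnA rec.
apply: (@leq_trans (4 * (3 * q).+4 * (3 * q).+3 * (3 * q).+2 * 27 ^ q)).
  rewrite expnS [(27 * _)%N]mulnC -mulnA mulnC leq_mul2r; apply/orP; right; nia.
have -> : (4 ^ q.+1 * (3 * q.+1).+1 *
    ((3 * q).+3 * (3 * q).+2 * (3 * q).+1 * 'C(3 * q, q)) =
  4 * (3 * q).+4 * (3 * q).+3 * (3 * q).+2 * (4 ^ q * (3 * q).+1 * 'C(3 * q, q)))%N.
  by rewrite expnS (_ : (3 * q.+1).+1 = (3 * q).+4)%N; [ring | lia].
by rewrite leq_mul2l IH orbT.
Qed.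

(** * The lower bound *)

Section LowerBound.
Variables (R : realType) (L : R).
Hypothesis count_le : forall n, (avoider_count n)%:R <= L ^+ n.

Let L_ge1 : 1 <= L.
Proof.
by apply: le_trans (count_le 1); rewrite ler1n avoider_count_ge1.
Qed.

Let L_ge0 : 0 <= L. Proof. exact: le_trans ler01 L_ge1. Qed.

(** One link of a chain of length [5 * p]: a domino with [2 * p] points in each
    cell, and an increasing cell with [p] points that interleaves on both sides. *)
Lemma domino_chain_le p :
  (domino_count (2 * p) (2 * p))%:R * 'C(3 * p, p)%:R ^+ 2 <= L ^+ (5 * p).
Proof.
apply: (@expr_le_poly _ _ _ (L ^+ p)); rewrite ?mulr_ge0 ?exprn_ge0 //.
move=> k; apply: (@le_trans _ _ (L ^+ p * L ^+ (5 * p) ^+ k)).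
  rewrite -exprM -exprD; apply: le_trans (count_le _).
  have := chain_count (2 * p) p k.
  have -> : (2 * p + p = 3 * p)%N by lia.
  have -> : (p + k * (2 * (2 * p) + p) = p + 5 * p * k)%N by lia.
  by rewrite -(ler_nat R) natrX natrM natrX.
rewrite -mulrA ler_wpM2l ?exprn_ge0 // ler_peMl ?exprn_ge0 //.
by rewrite exprn_ege1 // ler1n.
Qed.

Lemma domino_count_expr a b j :
  (domino_count a b ^ j <= domino_count (j * a) (j * b))%N.
Proof.
elim: j => [|j IH].
  rewrite expn0 !mul0n; apply/card_gt0P; exists 1%g; apply/asboolP.
  by split=> [? ? ? ? ? []|? ? ? ? ? []|? ? ? ? ? ?].
rewrite expnS !mulSn; apply: leq_trans (domino_count_super _ _ _ _).
by rewrite leq_mul2l IH orbT.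
Qed.

(** The binomial coefficients may be replaced by their growth rate: multiplying
    the size of a domino by [j] raises the number of dominoes at least to the
    power [j]. *)
Lemma domino_growth_le p :
  (domino_count (2 * p) (2 * p))%:R * (27 / 4) ^+ (2 * p) <= L ^+ (5 * p).
Proof.
apply: (@expr_le_poly _ _ _ ((3 * p).+1%:R ^+ 2));
  rewrite ?mulr_ge0 ?exprn_ge0 //.
move=> j; set D := domino_count _ _.
have DD : (D%:R : R) ^+ j <= (domino_count (2 * (p * j)) (2 * (p * j)))%:R.
  have := domino_count_expr (2 * p) (2 * p) j.
  by rewrite -(ler_nat R) natrX (_ : (j * (2 * p) = 2 * (p * j))%N) //; lia.
have B : (27 / 4 : R) ^+ (p * j) <= (3 * p).+1%:R * j.+1%:R * 'C(3 * (p * j), p * j)%:R.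
  have := bin3_lower (p * j); rewrite -(ler_nat R) !natrM !natrX => bin.
  have : (3 * (p * j)).+1%:R <= (3 * p).+1%:R * j.+1%:R :> R.
    by rewrite -natrM ler_nat; nia.
  move=> poly; rewrite expr_div_n ler_pdivrMr ?exprn_gt0 //.
  apply: le_trans bin _.
  rewrite [X in _ <= X]mulrC mulrA ler_wpM2r // ler_wpM2l ?exprn_ge0 //.
set B0 := 'C(_, _)%:R in B.
have B0_ge0 : 0 <= B0 by exact: ler0n.
have -> : (D%:R * (27 / 4) ^+ (2 * p)) ^+ j = D%:R ^+ j * ((27 / 4) ^+ (p * j)) ^+ 2 :> R.
  by rewrite exprMn -!exprM; congr (_ * _ ^+ _); lia.
apply: (@le_trans _ _ (D%:R ^+ j * ((3 * p).+1%:R * j.+1%:R * B0) ^+ 2)).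
  rewrite ler_wpM2l ?exprn_ge0 // ler_pXn2r ?nnegrE ?mulr_ge0 ?exprn_ge0 //; lra.
have -> : D%:R ^+ j * ((3 * p).+1%:R * j.+1%:R * B0) ^+ 2 =
  (3 * p).+1%:R ^+ 2 * j.+1%:R ^+ 2 * (D%:R ^+ j * B0 ^+ 2) by ring.
rewrite ler_wpM2l ?mulr_ge0 ?exprn_ge0 // -exprM -mulnA.
apply: le_trans (domino_chain_le (p * j)).
by rewrite ler_wpM2r ?exprn_ge0.
Qed.

(** A domino and its half-turn add up to one with cells of equal size. *)
Lemma domino_count_le a b (x : R) : 0 <= x ->
  L ^+ 5 <= x ^+ 4 * (27 / 4) ^+ 2 -> (domino_count a b)%:R <= x ^+ (a + b).
Proof.
move=> x0 Lx; set n := (a + b)%N.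
have sq : ((domino_count a b) ^ 4 <= domino_count (2 * n) (2 * n))%N.
  have D1 : (domino_count a b ^ 2 <= domino_count n n)%N.
    have := domino_count_super a b b a; rewrite [(b + a)%N]addnC; apply: leq_trans.
    by rewrite expnS expn1 leq_mul2l domino_count_sym orbT.
  apply: leq_trans (domino_count_expr n n 2).
  by rewrite (expnM _ 2 2) leq_exp2r.
rewrite -(@ler_pXn2r _ 4) ?nnegrE ?exprn_ge0 //.
have c0 : 0 < (27 / 4 : R) ^+ (2 * n) by rewrite exprn_gt0 //; lra.
rewrite -(ler_pM2r c0); apply: (@le_trans _ _ (L ^+ (5 * n))).
  apply: le_trans (domino_growth_le n); rewrite ler_wpM2r ?(ltW c0) //.
  by rewrite -natrX ler_nat.
have -> : x ^+ n ^+ 4 * (27 / 4) ^+ (2 * n) = (x ^+ 4 * (27 / 4) ^+ 2) ^+ n.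
  by rewrite [RHS]exprMn [_ ^+ (2 * n)]exprM [x ^+ n ^+ 4]exprAC.
have c27 : 0 <= 27 / 4 :> R by lra.
rewrite exprM; apply: lerXn2r => //; rewrite nnegrE ?mulr_ge0 ?exprn_ge0 //.
Qed.

End LowerBound.

Lemma arithmetico_geometric_le (R : realType) (x : R) N : 0 <= x -> x <= 1 ->
  (1 - x) ^+ 2 * \sum_(n < N) n.+1%:R * x ^+ n <= 1.
Proof.
move=> x0 x1.
have -> : (1 - x) ^+ 2 * \sum_(n < N) n.+1%:R * x ^+ n =
    1 - x ^+ N * (1 + N%:R * (1 - x)).
  elim: N => [|N IH]; first by rewrite big_ord0 mulr0 expr0 mul0r; ring.
  rewrite big_ord_recr /= mulrDr IH -natr1 [x ^+ N.+1]exprS.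
  have E (p q : R) : 1 - p * (1 + q * (1 - x)) + (1 - x) ^+ 2 * ((q + 1) * p) =
      1 - x * p * (1 + (q + 1) * (1 - x)) by ring.
  exact: E.
rewrite gerBl mulr_ge0 ?exprn_ge0 // addr_ge0 // mulr_ge0 //; lra.
Qed.

Theorem theorem4 (R : realType) :
  wilf_stanley_limit R [:: 4; 2; 3; 1]%N >= 935 / 100.
Proof.
have [L [cvL countL]] : exists L : R,
    (avoider_count n)%:R `^ n%:R^-1 @[n --> \oo] --> L /\
    forall n, (avoider_count n)%:R <= L ^+ n.
  apply: (@fekete _ _ 16%:R) => [n|n|m n].
  - by rewrite ler1n avoider_count_ge1.
  - by rewrite -natrX ler_nat avoider_count_le.
  - by rewrite -natrM ler_nat avoider_count_super.
have -> : wilf_stanley_limit R [:: 4; 2; 3; 1]%N = L.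
  rewrite /wilf_stanley_limit; under eq_fun do rewrite num_avoiders_count.
  exact: cvg_lim cvL.
rewrite leNgt; apply/negP => Llt.
(* [x = 6.294] slightly exceeds the fourth root of 9.35 ^ 5 / (27 / 4) ^ 2. *)
pose x : R := 63 / 10 - 3 / 500.
have x0 : 0 <= x by rewrite /x; lra.
have L0 : 0 <= L.
  apply: le_trans (countL 1%N); exact: ler0n.
have Lx : L ^+ 5 <= x ^+ 4 * (27 / 4) ^+ 2.
  apply: (@le_trans _ _ ((935 / 100) ^+ 5)).
    have c0 : 0 <= 935 / 100 :> R by lra.
    by have := @lerXn2r R 5 L (935 / 100); rewrite !nnegrE; apply => //; apply: ltW.
  by rewrite /x; lra.
have [N large] := weighted_growths_large R.
pose y := 20 / 127 * x.
have y0 : 0 <= y by rewrite /y /x; lra.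
have y1 : y <= 1 by rewrite /y /x; lra.
have small : \sum_(n < N.+1) (20 / 127 : R) ^+ n * (size (growths n))%:R <=
    \sum_(n < N.+1) n.+1%:R * y ^+ n.
  apply: ler_sum => n _; have w0 : 0 <= 20 / 127 :> R by lra.
  rewrite [y ^+ n]exprMn [X in _ <= X]mulrCA; apply: ler_wpM2l.
    exact: exprn_ge0.
  apply: (@le_trans _ _ (\sum_(a < n.+1) x ^+ n)); last first.
    by rewrite sumr_const card_ord mulr_natl.
  apply: (@le_trans _ _ (\sum_(a < n.+1) domino_count a (n - a))%N%:R).
    by rewrite ler_nat size_growths_le.
  rewrite natr_sum; apply: ler_sum => a _.
  have := domino_count_le countL a (n - a) x0 Lx.
  by rewrite subnKC // -ltnS.
have := arithmetico_geometric_le N.+1 y0 y1.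
have : (1 - y) ^+ 2 * (20 * 1000) <= (1 - y) ^+ 2 * \sum_(n < N.+1) n.+1%:R * y ^+ n.
  by rewrite ler_wpM2l ?sqr_ge0 //; apply: le_trans large small.
have : 1 < (1 - y) ^+ 2 * (20 * 1000) by rewrite /y /x; lra.
by lra.
Qed.
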